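(* Let $\lambda$ be a reflected skew shape. The twist map $\mathrm{Tw}$ is a bijection between descent sets of tableaux of shape $\lambda$, i.e. the sets $\mathrm{Des}(T)$ for $T$ a standard Young tableau of shape $\lambda$, and nonfriendly sets of segments of $\lambda$. Moreover, if $X$ is the descent set of a tableau, then $X$ and $\mathrm{Tw}(X)$ have the same number of segments and the same number of isolated lazy segments.
   Context: A shape is a finite vertex-induced subgraph $\lambda$ of the square grid $\mathbb{Z}^2$, with vertical edges oriented down and horizontal edges oriented to the right. $(a,b)$ is immediately South of $(a,b+1)$ and immediately East of $(a-1,b)$; North and West are the reverse relations. A vertex of $\lambda$ is an interior vertex if all four of its neighbors in $\mathbb{Z}^2$ are in $\lambda$. The cell $\lambda_{(i,j)}$ at $(i,j)$ is the unit square with vertices $(i,j),(i+1,j),(i,j+1),(i+1,j+1)$; it is contained in $\lambda$ if these four points are vertices of $\lambda$. Its NW-corner is $(i,j+1)$ and its SE-corner is $(i+1,j)$. $\lambda$ is a reflected skew shape if: (1) whenever $(i,j)$ and $(i+1,j-1)$ are vertices of $\lambda$, so are $(i,j-1)$ and $(i+1,j)$; and (2) for any two cells $\lambda_{(a,b)},\lambda_{(c,d)}$ contained in $\lambda$ there are two sequences of cells contained in $\lambda$, $\lambda_{(a_0,b_0)},\ldots,\lambda_{(a_l,b_l)}$ and $\lambda_{(c_0,d_0)},\ldots,\lambda_{(c_l,d_l)}$, with $(a_0,b_0)=(c_0,d_0)$, $(a_l,b_l)=(c_l,d_l)$, $(a,b)=(a_i,b_i)$ and $(c,d)=(c_j,d_j)$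 for some $i,j$, such that for each $k\in\{1,\dots,l\}$ the $k$-th cell in each sequence is immediately North or immediately East of the $(k-1)$-st cell of that sequence. A segment is a sequence of interior vertices $(v_0,\ldots,v_l)$, $l\ge0$, with each $v_i$ immediately South or East of $v_{i-1}$ ($v_0$ is its initial and $v_l$ its terminal vertex); it is lazy if it has only one vertex. A lazy segment in a set $S$ of segments is isolated if it is not contained in any other member of $S$. If $u=(v_i,\dots,v_j)$ is a contiguous subsequence of a segment $s=(v_0,\dots,v_l)$, then $s$ starts with $u$ if $i=0$ and otherwise enters $u$ from the West (resp. North) if $v_{i-1}$ is immediately West (resp. North) of $v_i$; $s$ ends with $u$ if $j=l$ and otherwise leaves $u$ to the East (resp. South) if $v_{j+1}$ is immediately East (resp. South) of $v_j$. Two segments $s,t$ are friendly along a common subsegment $u$ if, up to exchanging $s$ and $t$: $s$ starts with $u$ or enters $u$ from the West, and $s$ ends with $u$ or leaves $u$ to the South; and $t$ starts with $u$ or enters $u$ from the North, and $t$ ends with $u$ or leaves $u$ to the East. A set of segments is nonfriendly if no two distinct members are friendly along any segment. Let $Q_\lambda$ be the poset of cells contained in $\lambda$ with $\lambda_{(a,b)}\le\lambda_{(c,d)}$ iff $a\le c$ and $b\le d$, and let $N$ be the number of cells. A standard Young tableau of shape $\lambda$ is a linear extension of $Q_\lambda$, viewed as a bijective filling of the cells by $1,\dots,N$ with labels increasing to the East and North. An integer $i\in\{1,\dots,N-1\}$ is a descent of $T$ if the cell $\lambda_{i+1}$ containing $i+1$ is strictly Northwest (strictly North and strictly West) of the cell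 $\lambda_i$ containing $i$. To such a descent one associates the unique segment on the boundary of the union of the cells with labels at most $i+1$ whose endpoints are the SE-corner of $\lambda_{i+1}$ and the NW-corner of $\lambda_i$. $\mathrm{Des}(T)$ is the set of segments associated to descents of $T$. Twist map: mark each interior vertex as a starter, a closer, both, or neither, and place a nonnegative integer weight $\omega_e$ on each edge $e$ between two interior vertices (all other edges have weight $0$). Such data is balanced if at every interior vertex $v$ the sum of the weights of the two incoming edges minus the sum of the weights of the two outgoing edges is $1$ if $v$ is a closer but not a starter, $-1$ if $v$ is a starter but not a closer, and $0$ otherwise. To a set $X$ of segments that is either a descent set of a tableau or a nonfriendly set, associate the balanced data in which $\omega_e$ is the number of segments in $X$ containing the edge $e$, the starters are the initial vertices of segments in $X$, and the closers are the terminal vertices of segments in $X$. For a descent set $X$, $\mathrm{Tw}(X)$ is the unique nonfriendly set of segments with the same associated balanced data (edge weights, starters and closers) as $X$ (its existence and uniqueness being part of the assertion).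
   Formalization: A vertex counts as interior when all four cells around it are contained in λ, not merely its four neighbors; with the four-neighbor definition the claim fails, e.g. for the 3×3 vertex grid without its NW vertex (one descent set, two nonfriendly sets). *)

(* Defs.v *)
From HB Require Import structures.
From mathcomp Require Import all_boot all_order all_algebra finmap.
From mathcomp Require Import boolp classical_sets functions.
Set Implicit Arguments.
Unset Strict Implicit.
Unset Printing Implicit Defensive.
Import Order.TTheory GRing.Theory Num.Theory.
Local Open Scope ring_scope.

Definition vertex : choiceType := (int * int)%type.

(* A vertex-induced subgraph is given by its set of vertices. *)
Definition grid_shape : Type := {fset vertex}.

(* A cell is named by its south-west corner. *)
Definition cell : choiceType := vertex.

Definition north (v : vertex) : vertex := (v.1, v.2 + 1).
Definition south (v : vertex) : vertex := (v.1, v.2 - 1).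
Definition east (v : vertex) : vertex := (v.1 + 1, v.2).
Definition west (v : vertex) : vertex := (v.1 - 1, v.2).

Definition corners (c : cell) : seq vertex :=
  [:: c; east c; north c; north (east c)].

Definition cells (l : grid_shape) : {fset cell} :=
  [fset c in l | all (fun v => v \in l) (corners c)]%fset.

Definition around (v : vertex) : seq cell :=
  [:: v; west v; south v; south (west v)].

(* The whole 2 x 2 block of cells centred at v lies in l; in particular v and
   its four neighbours do.  Asking for the four neighbours only is too weak: for
   the 3 x 3 grid of vertices without its north-west vertex, the poset of cells
   is a chain, so that the empty set is the only descent set, while the central
   vertex would carry a lazy segment, hence a second nonfriendly set. *)
Definition interior_vertex (l : grid_shape) (v : vertex) : bool :=
  all (fun c => c \in cells l) (around v).

Definition ne_step (c d : cell) : bool := (d == north c) || (d == east c).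

Definition reflected_skew_shape (l : grid_shape) : Prop :=
  (forall i j : int, (i, j) \in l -> (i + 1, j - 1) \in l ->
     (i, j - 1) \in l /\ (i + 1, j) \in l) /\
  (forall c d : cell, c \in cells l -> d \in cells l ->
     exists (a : cell) (p q : seq cell),
       [/\ path ne_step a p /\ path ne_step a q,
           size p = size q /\ last a p = last a q,
           {subset a :: p <= cells l} /\ {subset a :: q <= cells l},
           c \in a :: p
         & d \in a :: q]).

Definition se_step (v w : vertex) : bool := (w == south v) || (w == east v).

Definition segment (l : grid_shape) (s : seq vertex) : bool :=
  [&& s != [::], all (interior_vertex l) s & sorted se_step s].

Definition initial (s : seq vertex) : vertex := head (0, 0) s.
Definition terminal (s : seq vertex) : vertex := last (0, 0) s.

Definition isolated_lazy (X : {fset seq vertex}) (s : seq vertex) : bool :=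
  (size s == 1)%N && all (fun t => (t != s) ==> ~~ infix s t) X.

Definition n_isolated_lazy (X : {fset seq vertex}) : nat :=
  #|` [fset s in X | isolated_lazy X s]%fset|.

(* The vertices of a segment are distinct, so u has at most one position in s:
   each predicate below is about that position. *)
Definition starts_with (s u : seq vertex) : bool := prefix u s.
Definition ends_with (s u : seq vertex) : bool := suffix u s.
Definition enters_from (dir : vertex -> vertex) (s u : seq vertex) : bool :=
  if u is x :: _ then infix (dir x :: u) s else false.
Definition leaves_to (dir : vertex -> vertex) (s u : seq vertex) : bool :=
  if u is x :: u' then infix (rcons u (dir (last x u'))) s else false.

Definition friendly_ordered (s t u : seq vertex) : bool :=
  [&& starts_with s u || enters_from west s u,
      ends_with s u || leaves_to south s u,
      starts_with t u || enters_from north t u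
    & ends_with t u || leaves_to east t u].

Definition friendly_along (s t u : seq vertex) : bool :=
  [&& infix u s, infix u t & friendly_ordered s t u || friendly_ordered t s u].

Definition nonfriendly_set (l : grid_shape) (X : {fset seq vertex}) : Prop :=
  (forall s, s \in X -> segment l s) /\
  (forall s t u, s \in X -> t \in X -> s != t -> segment l u ->
     ~~ friendly_along s t u).

Definition cell_le (c d : cell) : bool := (c.1 <= d.1) && (c.2 <= d.2).

Definition n_cells (l : grid_shape) : nat := #|` cells l|.

(* The values of T off the cells of l are irrelevant. *)
Definition standard_tableau (l : grid_shape) (T : cell -> nat) : Prop :=
  set_bij [set` cells l]%classic [set k | (1 <= k <= n_cells l)%N]%classic T /\
  (forall c d, c \in cells l -> d \in cells l -> cell_le c d -> (T c <= T d)%N).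

Definition cell_of (l : grid_shape) (T : cell -> nat) (k : nat) : cell :=
  xget (0, 0) [set c | c \in cells l /\ T c = k]%classic.

Definition strictly_nw (d c : cell) : bool := (d.1 < c.1) && (c.2 < d.2).

Definition descent (l : grid_shape) (T : cell -> nat) (i : nat) : bool :=
  (1 <= i <= (n_cells l).-1)%N && strictly_nw (cell_of l T i.+1) (cell_of l T i).

(* Boundary of a union of unit squares: a grid vertex is on it iff some but not
   all of the four squares at that vertex are in U, a unit edge is on it iff
   exactly one of the two squares containing that edge is in U. *)
Definition vertex_on_boundary (U : pred cell) (v : vertex) : bool :=
  (0 < count U (around v) < 4)%N.
Definition edge_on_boundary (U : pred cell) (v w : vertex) : bool :=
  count U [seq c <- around v | c \in around w] == 1%N.
Definition on_boundary (U : pred cell) (s : seq vertex) : bool :=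
  all (vertex_on_boundary U) s && sorted (edge_on_boundary U) s.

Definition below (l : grid_shape) (T : cell -> nat) (k : nat) : pred cell :=
  fun c => (c \in cells l) && (T c <= k)%N.

Definition is_descent_segment (l : grid_shape) (T : cell -> nat) (i : nat)
    (s : seq vertex) : Prop :=
  [/\ segment l s, on_boundary (below l T i.+1) s,
      initial s = east (cell_of l T i.+1)
    & terminal s = north (cell_of l T i)].

Definition descent_segment (l : grid_shape) (T : cell -> nat) (i : nat) : seq vertex :=
  xget [::] [set s | is_descent_segment l T i s]%classic.

Definition Des (l : grid_shape) (T : cell -> nat) : {fset seq vertex} :=
  [fset descent_segment l T i | i in iota 1 (n_cells l).-1 & descent l T i]%fset.

Definition is_descent_set (l : grid_shape) (X : {fset seq vertex}) : Prop :=
  exists2 T : cell -> nat, standard_tableau l T & X = Des l T.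

(* weight v w is the weight of the edge from v to w. *)
Record twist_data := TwistData {
  weight : vertex -> vertex -> nat;
  starter : pred vertex;
  closer : pred vertex }.

Definition same_data (D E : twist_data) : Prop :=
  [/\ weight D =2 weight E, starter D =1 starter E & closer D =1 closer E].

Definition balanced (l : grid_shape) (D : twist_data) : Prop :=
  [/\ forall v w, weight D v w != 0%N ->
        [&& interior_vertex l v, interior_vertex l w & se_step v w],
      forall v, starter D v || closer D v -> interior_vertex l v
    & forall v, interior_vertex l v ->
        ((weight D (west v) v + weight D (north v) v)%N%:Z
           - (weight D v (east v) + weight D v (south v))%N%:Z)
        = (closer D v)%:Z - (starter D v)%:Z].

Definition data_of (X : {fset seq vertex}) : twist_data := {|
  weight := fun v w => #|` [fset s in X | infix [:: v; w] s]%fset|;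
  starter := fun v => has (fun s => initial s == v) X;
  closer := fun v => has (fun s => terminal s == v) X |}.

Definition is_twist (l : grid_shape) (X Y : {fset seq vertex}) : Prop :=
  nonfriendly_set l Y /\ same_data (data_of Y) (data_of X).

Definition Tw (l : grid_shape) (X : {fset seq vertex}) : {fset seq vertex} :=
  xget fset0%fset [set Y | is_twist l X Y]%classic.

(* Main.v *)
(** Both kinds of sets are determined by their balanced data because at each
   vertex the data leave only one way to join incoming to outgoing strands.  Order
   the strands through a vertex by where they come from (West, then starting
   there, then North; strands using the same edge are compared further back).
   A set is nonfriendly iff, in this order, the strands leave East first, then end,
   then leave South.  For a descent set the order is the order in time, and the
   strands leave South first, then end, then leave East.  So in both cases the set
   is rebuilt from its data diagonal by diagonal; in the nonfriendly case the
   rebuilding works for every balanced datum.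

   It remains to realize balanced data by a tableau.  Add cells one at a time, with
   the segments of the descents met so far removed from the data.  If the NW-corner
   of the last cell is a closer, the edges of positive weight lead back along the
   boundary of the placed cells to the SE-corner of an addable cell; adding this
   cell is a descent, whose segment is removed.  Otherwise add the leftmost addable
   cell that is not a starter and around which all weight is used up.  Balance at
   the boundary vertices shows that the process never gets stuck.

   Finally, segments of either set correspond to starters, and isolated lazy
   segments to vertices that are starters and closers and carry no weight. *)
Require Import Defs.
From mathcomp Require Import all_boot all_order all_algebra finmap.
From mathcomp Require Import boolp classical_sets functions.
From mathcomp Require Import zify.
Set Implicit Arguments.
Unset Strict Implicit.
Unset Printing Implicit Defensive.
Import Order.TTheory GRing.Theory Num.Theory.
Local Open Scope ring_scope.

(** * Grid geometry and the cells of a reflected skew shape *)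

(** The coordinate [ct] is the clock of the argument. Each step of a segment raises it by one, so
    segments have distinct vertices, and an order ideal has at most one interior boundary vertex on
    each diagonal. It also detects descents: a cell strictly Northwest of another lies at least two
    diagonals lower. Always adding the leftmost available cell when no closer calls for a descent
    keeps the cells available later at most one diagonal to the left of the last one, so no unwanted
    descent arises. The conditions on the shape act through two consequences. Cells are closed under
    joins and fill every rectangle spanned by a Northwest-Southeast pair, so the boundary path of a
    descent runs through interior vertices. And a cell may be added as soon as its direct
    predecessors are placed. The nonfriendly and the descent case differ only in the order of exits,
    so uniqueness is proved once, with a boolean [o]. For [o] false the rebuilding gives just one
    candidate and does not show that it comes from a tableau; hence the separate construction of a
    tableau. *)

Definition ct (v : vertex) : int := v.1 - v.2.

Ltac vtx :=
  rewrite /se_step /ne_step /cell_le /ct /north /south /east /west ?xpair_eqE /=;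
  intros; try (match goal with |- @eq _ (_, _) _ => idtac end; congr pair); lia.

(* [simpl] turns [Choice.sort vertex] into [int * int]; doing so everywhere lets [lia]
   identify the atoms. *)
Ltac slia := simpl in *; lia.

Lemma westK v : east (west v) = v. Proof. by case: v => a b; vtx. Qed.
Lemma eastK v : west (east v) = v. Proof. by case: v => a b; vtx. Qed.
Lemma southK v : north (south v) = v. Proof. by case: v => a b; vtx. Qed.
Lemma northK v : south (north v) = v. Proof. by case: v => a b; vtx. Qed.
Lemma south_west v : south (west v) = west (south v). Proof. by []. Qed.
Lemma south_east v : south (east v) = east (south v). Proof. by []. Qed.
Lemma ct_east v : ct (east v) = ct v + 1. Proof. by vtx. Qed.
Lemma ct_west v : ct (west v) = ct v - 1. Proof. by vtx. Qed.
Lemma ct_north v : ct (north v) = ct v - 1. Proof. by vtx. Qed.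
Lemma ct_south v : ct (south v) = ct v + 1. Proof. by vtx. Qed.
Definition ctE := (ct_east, ct_west, ct_north, ct_south).
Lemma ct_step v w : se_step v w -> ct w = ct v + 1.
Proof. by case/orP => /eqP ->; rewrite ctE. Qed.
Lemma south_neq_east v : south v != east v.
Proof. by case: v => a b; vtx. Qed.
Lemma west_neq_north v : west v != north v.
Proof. by case: v => a b; vtx. Qed.
Lemma se_stepP v w : se_step v w = (v == north w) || (v == west w).
Proof. by case: v w => a b [c d]; vtx. Qed.

Lemma cell_le_refl c : cell_le c c. Proof. by vtx. Qed.
Lemma cell_le_trans c d e : cell_le c d -> cell_le d e -> cell_le c e.
Proof. by vtx. Qed.
Lemma cell_le_anti c d : cell_le c d -> cell_le d c -> c = d.
Proof. by case: c d => a b [c d]; vtx. Qed.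

Lemma le_east v : cell_le v (east v). Proof. by vtx. Qed.
Lemma le_north v : cell_le v (north v). Proof. by vtx. Qed.
Lemma west_le v : cell_le (west v) v. Proof. by vtx. Qed.
Lemma south_le v : cell_le (south v) v. Proof. by vtx. Qed.

Lemma seq_argmin (T : eqType) (f : T -> int) (P : pred T) (A : seq T) x0 :
  x0 \in A -> P x0 ->
  exists x, [/\ x \in A, P x & forall y, y \in A -> P y -> f x <= f y].
Proof.
elim: A x0 => [|a A IH] x0 //; rewrite inE => xA Px.
have [[x1 x1A Px1]|no] := pselect (exists2 x1, x1 \in A & P x1).
  have [x [xA' Px' xmin]] := IH x1 x1A Px1.
  have [/andP[Pa ax]|Na] := boolP (P a && (f a <= f x)).
    exists a; split; rewrite ?mem_head // => y; rewrite inE => /orP[/eqP->//|yA Py].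
    exact: le_trans ax (xmin _ yA Py).
  exists x; split; rewrite ?inE ?xA' ?orbT // => y; rewrite inE => /orP[/eqP->|]; last exact: xmin.
  by move=> Pa; move: Na; rewrite Pa /= -ltNge; apply: ltW.
have xA0 : x0 \in a :: A by rewrite inE.
exists x0; split=> // y yA Py.
have E z : z \in a :: A -> P z -> z = a.
  by rewrite inE => /orP[/eqP//|zA Pz]; case: no; exists z.
by rewrite [x0](E _ xA0 Px) [y](E _ yA Py).
Qed.

Section Geometry.
Variable l : grid_shape.
Hypothesis hl : reflected_skew_shape l.
Notation K := (cells l).

Lemma cellsE c : (c \in K) = [&& c \in l, east c \in l, north c \in l & north (east c) \in l].
Proof. by rewrite !inE /= andbT; case: (c \in l). Qed.

Lemma interiorE v :
  interior_vertex l v = [&& v \in K, west v \in K, south v \in K & south (west v) \in K].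
Proof. by rewrite /interior_vertex /= andbT. Qed.

(** Condition (1) applied to the vertices West and South of [v] supplies the SW corner of the block,
    and applied to those North and East of [v] its NE corner; the two given cells contain the other
    seven vertices. *)
Lemma interior_nw_se v : west v \in K -> south v \in K -> interior_vertex l v.
Proof.
rewrite interiorE !cellsE => /and4P[w1 w2 w3 w4] /and4P[s1 s2 s3 s4].
have E1 := hl.1; move: w1 w2 w3 w4 s1 s2 s3 s4.
rewrite westK southK -[north (east (south v))]/(east (north (south v))) southK => w1 w2 w3 w4 s1 s2 s3 s4.
have Q0 := E1 _ _ w1; rewrite subrK in Q0; have [Q1 _] := Q0 s1.
have Q := E1 _ _ w4; rewrite /= addrK in Q; have [_ Q4] := Q s4.
have -> : north (west v) = west (north v) by [].
rewrite -[north (east (south (west v)))]/(east (north (south (west v)))).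
rewrite -[east (south (west v))]/(south (east (west v))) !southK !westK.
by rewrite w1 w2 w3 w4 s1 s2 s4 Q1 Q4.
Qed.

Definition join (x y : cell) : cell := (Num.max x.1 y.1, Num.max x.2 y.2).
(** Joining a chain with a fixed cell can collapse a step, hence the reflexive version. *)
Definition weak_step (c d : cell) : bool := (d == c) || ne_step c d.

Lemma interior_ne v : interior_vertex l v -> v \in K.
Proof. by rewrite interiorE => /and4P[]. Qed.

(** If [a'] sticks out of [b] in one direction and [b1] steps in the other, then [join a' b] and
    [b1] are, in some order, the NW and SE cells at the vertex naming [join a' b1]. In all other
    cases this join is [b1] or [join a' b] itself. *)
Lemma join_step a a' b b1 : ne_step a a' -> weak_step b b1 -> cell_le a b ->
  b \in K -> b1 \in K -> join a' b \in K -> join a' b1 \in K.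
Proof.
move=> sa sb ab Kb Kb1 Kj.
case/or3P: sb => /eqP E; first by rewrite E.
  case/orP: sa => /eqP E'.
    suff -> : join a' b1 = b1 by [].
    by rewrite /join E E'; case: a b ab {E E' Kb Kj} => a2 a3 [b2 b3]; vtx.
  have [ge|lt] := lerP (a.1 + 1) b.1.
    suff -> : join a' b1 = b1 by [].
    by rewrite /join E E'; case: a b ab ge {E E' Kb Kj} => a2 a3 [b2 b3] + /=; vtx.
  have Eb : join a' b = east b.
    by rewrite /join E'; case: a b ab lt {E E' Kb Kj} => a2 a3 [b2 b3] /= + ?; vtx.
  have -> : join a' b1 = north (east b).
    by rewrite /join E E'; case: a b ab lt {E E' Kb Kj Eb} => a2 a3 [b2 b3] /= + ?; vtx.
  apply/interior_ne/interior_nw_se; last by rewrite northK -Eb.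
  by rewrite -[west _]/(north (west (east b))) eastK -E.
case/orP: sa => /eqP E'; last first.
  suff -> : join a' b1 = b1 by [].
  by rewrite /join E E'; case: a b ab {E E' Kb Kj} => a2 a3 [b2 b3]; vtx.
have [ge|lt] := lerP (a.2 + 1) b.2.
  suff -> : join a' b1 = b1 by [].
  by rewrite /join E E'; case: a b ab ge {E E' Kb Kj} => a2 a3 [b2 b3] + /=; vtx.
have Eb : join a' b = north b.
  by rewrite /join E'; case: a b ab lt {E E' Kb Kj} => a2 a3 [b2 b3] /= + ?; vtx.
have -> : join a' b1 = east (north b).
  by rewrite /join E E'; case: a b ab lt {E E' Kb Kj Eb} => a2 a3 [b2 b3] /= + ?; vtx.
apply/interior_ne/interior_nw_se; first by rewrite eastK -Eb.
by rewrite south_east northK -E.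
Qed.

Lemma weak_step_join a b b1 : weak_step b b1 -> weak_step (join a b) (join a b1).
Proof.
case/or3P => /eqP ->; rewrite /weak_step /join /ne_step ?eqxx //; case: a b => a2 a3 [b2 b3]; vtx.
Qed.

Lemma weak_step_le b b1 : weak_step b b1 -> cell_le b b1.
Proof. by case/or3P => /eqP ->; vtx. Qed.

Lemma weak_path_le b q : path weak_step b q -> cell_le b (last b q).
Proof.
elim: q b => [|b1 q IH] b /=; first by rewrite cell_le_refl.
by case/andP => /weak_step_le H /IH; apply: cell_le_trans.
Qed.

Lemma join_path a a' b q : ne_step a a' -> cell_le a b -> path weak_step b q ->
  {subset b :: q <= K} -> join a' b \in K ->
  path weak_step (join a' b) (map (join a') q) /\ {subset map (join a') q <= K}.
Proof.
move=> sa; elim: q b => [|b1 q IH] b ab //= /andP[sb pq] sK Kj.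
have Kb : b \in K by apply: sK; rewrite mem_head.
have Kb1 : b1 \in K by apply: sK; rewrite !inE eqxx orbT.
have Kj1 := join_step sa sb ab Kb Kb1 Kj.
have [|x xq|//|H1 H2] := IH b1 _ pq.
- exact: cell_le_trans ab (weak_step_le sb).
- by apply: sK; rewrite inE xq orbT.
rewrite weak_step_join //; split=> // x; rewrite inE => /orP[/eqP->//|]; exact: H2.
Qed.

Lemma ne_weak a p : path ne_step a p -> path weak_step a p.
Proof. by apply: sub_path => x y xy; rewrite /weak_step xy orbT. Qed.

(** Each step of [p] lifts the whole chain [q] by joining it with the new cell. Once [p] is used up,
    the lifted chain runs from the end of [p] to the join of the two ends. *)
Lemma join_paths a p q : path ne_step a p -> {subset a :: p <= K} ->
  path weak_step a q -> {subset a :: q <= K} ->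
  exists r, [/\ path weak_step (last a p) r, {subset last a p :: r <= K}
              & last (last a p) r = join (last a p) (last a q)].
Proof.
elim: p a q => [|a' p IH] a q /=.
  move=> _ _ pq sK; exists q; split=> //.
  have := weak_path_le pq; case: (a) (last a q) => a1 a2 [b1 b2]; rewrite /join; vtx.
move=> /andP[sa pp] sK pq sKq.
have Kj : join a' a \in K.
  suff -> : join a' a = a' by apply: sK; rewrite !inE eqxx orbT.
  by case/orP: sa => /eqP ->; case: (a) => a1 a2; rewrite /join; vtx.
have ja : join a' a = a'.
  by case/orP: sa => /eqP ->; case: (a) => a1 a2; rewrite /join; vtx.
have [] := join_path sa (cell_le_refl a) pq sKq Kj; rewrite ja => H1 H2.
have [||r [R1 R2 R3]] := IH a' (map (join a') q) pp _ H1.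
- by move=> x xp; apply: sK; rewrite inE xp orbT.
- by move=> x; rewrite inE => /orP[/eqP->|/H2//]; rewrite -ja.
exists r; split=> //; have E := last_map (join a') q a; rewrite ja in E; rewrite R3 E.
have := weak_path_le (ne_weak pp); rewrite /join /cell_le /=.
by case/andP => le1 le2; congr pair; lia.
Qed.

Lemma path_to x p a : path ne_step a p -> x \in a :: p ->
  exists p', [/\ path ne_step a p', {subset a :: p' <= a :: p} & last a p' = x].
Proof.
move=> pp; rewrite inE => /orP[/eqP->|xp].
  by exists [::]; split=> // y; rewrite !inE => ->.
case/path.splitP: xp pp => p1 p2; rewrite cat_path => /andP[pp1 _].
exists (rcons p1 x); split=> //; last by rewrite last_rcons.
by move=> y; rewrite !inE mem_cat => /orP[->//|->]; rewrite orbT.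
Qed.

Lemma common_lower c d : c \in K -> d \in K -> exists a p q,
  [/\ path ne_step a p, {subset a :: p <= K}, last a p = c,
      path ne_step a q & {subset a :: q <= K} /\ last a q = d].
Proof.
move=> Kc Kd; have [a [p [q [[pp pq] _ [sp sq] cp dq]]]] := hl.2 _ _ Kc Kd.
have [p' [P1 P2 P3]] := path_to pp cp; have [q' [Q1 Q2 Q3]] := path_to pq dq.
exists a, p', q'; split=> //; last by split=> // x /Q2 /sq.
by move=> x /P2 /sp.
Qed.

Lemma cells_join c d : c \in K -> d \in K -> join c d \in K.
Proof.
move=> Kc Kd; have [a [p [q [P1 P2 P3 Q1 [Q2 Q3]]]]] := common_lower Kc Kd.
have [r [_ R2]] := join_paths P1 P2 (ne_weak Q1) Q2.
by rewrite P3 Q3 in R2 * => <-; apply: R2; rewrite mem_last.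
Qed.

(* Joining c to a chain that leads to d gives a chain from c to d inside the shape;
   this is its last step. *)
Lemma cell_pred c d : c \in K -> d \in K -> cell_le c d -> c != d ->
  (west d \in K /\ cell_le c (west d)) \/ (south d \in K /\ cell_le c (south d)).
Proof.
move=> Kc Kd cd; have [a [p [q [P1 P2 P3 Q1 [Q2 Q3]]]]] := common_lower Kc Kd.
have [r [R1 R2 R3]] := join_paths P1 P2 (ne_weak Q1) Q2.
have E : join c d = d by case: c d cd {Kc Kd P3 Q3} => a1 a2 [b1 b2]; rewrite /join; vtx.
rewrite P3 Q3 E {p q P1 P2 P3 Q1 Q2 Q3} in R1 R2 R3.
elim/last_ind: r d R1 R2 R3 {Kd cd E} => [|r e IH] d.
  by move=> _ _ /= ->; rewrite eqxx.
rewrite rcons_path last_rcons => /andP[R1 st] R2 <-{d}.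
have Kl : last c r \in K.
  by apply: R2; have := mem_last c r; rewrite !inE mem_rcons inE => /orP[->|->]; rewrite ?orbT.
have cl := weak_path_le R1.
case/or3P: st => /eqP ->; [|by right; rewrite northK|by left; rewrite eastK].
apply: IH => // x xr; apply: R2; rewrite inE mem_rcons inE.
by move: xr; rewrite inE => /orP[->//|->]; rewrite !orbT.
Qed.

Lemma path_row a p t : path ne_step a p -> {subset a :: p <= K} ->
  a.2 <= t <= (last a p).2 -> exists2 x, (x, t) \in K & x <= (last a p).1.
Proof.
elim: p a => [|a' p IH] a /=.
  move=> _ sK at2; exists a.1 => //.
  suff <- : a = (a.1, t) by apply: sK; rewrite mem_head.
  by case: a at2 {sK} => a1 a2 /=; vtx.
case/andP=> sa pp sK /andP[at1 at2].
have le := weak_path_le (ne_weak pp).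
have [at3|at3] := eqVneq a.2 t.
  exists a.1; last by move: le sa; case: a a' {at1 at2 IH pp sK at3} => [? ?] [? ?]; case: (last _ _) => ? ?; vtx.
  by rewrite -at3 -surjective_pairing; apply: sK; rewrite mem_head.
apply: IH => //; first by move=> x xp; apply: sK; rewrite inE xp orbT.
rewrite at2 andbT; move: sa at1 at3; case: a a' {at2 pp sK le} => [? ?] [? ?]; vtx.
Qed.

Lemma path_col a p t : path ne_step a p -> {subset a :: p <= K} ->
  a.1 <= t <= (last a p).1 -> exists2 y, (t, y) \in K & y <= (last a p).2.
Proof.
elim: p a => [|a' p IH] a /=.
  move=> _ sK at2; exists a.2 => //.
  suff <- : a = (t, a.2) by apply: sK; rewrite mem_head.
  by case: a at2 {sK} => a1 a2 /=; vtx.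
case/andP=> sa pp sK /andP[at1 at2].
have le := weak_path_le (ne_weak pp).
have [at3|at3] := eqVneq a.1 t.
  exists a.2; last by move: le sa; case: a a' {at1 at2 IH pp sK at3} => [? ?] [? ?]; case: (last _ _) => ? ?; vtx.
  by rewrite -at3 -surjective_pairing; apply: sK; rewrite mem_head.
apply: IH => //; first by move=> x xp; apply: sK; rewrite inE xp orbT.
rewrite at2 andbT; move: sa at1 at3; case: a a' {at2 pp sK le} => [? ?] [? ?]; vtx.
Qed.

(** A chain from a common lower cell up to [d] meets the row [y] weakly West of [d], and one up to
    [c] meets the column [x] weakly South of [c]; the join of these two cells is [(x, y)]. *)
Lemma cells_rectangle c d x y : d \in K -> c \in K ->
  d.1 <= x <= c.1 -> c.2 <= y <= d.2 -> (x, y) \in K.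
Proof.
move=> Kd Kc hx hy; have [a [p [q [P1 P2 P3 Q1 [Q2 Q3]]]]] := common_lower Kd Kc.
have := weak_path_le (ne_weak P1); have := weak_path_le (ne_weak Q1).
rewrite P3 Q3 /cell_le => /andP[ac1 ac2] /andP[ad1 ad2].
have [|x1 K1 le1] := @path_row a p y P1 P2; first by rewrite P3; lia.
have [|y1 K2 le2] := @path_col a q x Q1 Q2; first by rewrite Q3; lia.
suff -> : (x, y) = join (x1, y) (x, y1) by apply: cells_join.
move: le1 le2; rewrite P3 Q3 /join => le1 le2; congr pair; symmetry.
  by apply: max_r; apply: le_trans le1 _; case/andP: hx.
by apply: max_l; apply: le_trans le2 _; case/andP: hy.
Qed.

Lemma rectangle_interior c d v : d \in K -> c \in K ->
  d.1 < v.1 <= c.1 -> c.2 < v.2 <= d.2 -> interior_vertex l v.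
Proof.
move=> Kd Kc hx hy; rewrite interiorE; case: v hx hy => x y /= hx hy.
by apply/and4P; split; apply: (cells_rectangle Kd Kc); rewrite /=; lia.
Qed.

(** A cell of least coordinate sum has a common lower cell with any [c], and this can only be the
    cell itself. The construction of a tableau begins with it. *)
Lemma cells_min : K != fset0 -> exists2 m, m \in K & forall c, c \in K -> cell_le m c.
Proof.
case/fset0Pn => c0 Kc0.
have [m [Km _ mmin]] := @seq_argmin _ (fun c : cell => c.1 + c.2) (mem K) (enum_fset K) c0 Kc0 Kc0.
exists m => // c Kc; have [a [p [q [P1 P2 P3 Q1 [Q2 Q3]]]]] := common_lower Km Kc.
have := weak_path_le (ne_weak P1); have := weak_path_le (ne_weak Q1).
have Ka : a \in K by apply: P2; rewrite mem_head.
rewrite P3 Q3; have := mmin _ Ka Ka.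
case: (a) (m) (c) => [? ?] [? ?] [? ?]; vtx.
Qed.
End Geometry.

(** * Segments and their flow *)

Section Segments.
Variable l : grid_shape.


Lemma uniq_split (T : eqType) (a a' c c' : seq T) x : uniq (a ++ x :: c) ->
  a ++ x :: c = a' ++ x :: c' -> a = a' /\ c = c'.
Proof.
move=> us E.
have na : forall b d, uniq (b ++ x :: d) -> index x (b ++ x :: d) = size b.
  move=> b d; rewrite cat_uniq index_cat /= eqxx addn0 => /and3P[_ /norP[/negPf -> _] _].
  by [].
have sz : size a = size a' by rewrite -(na _ _ us) {1}E na // -E.
move/eqP: E; rewrite eqseq_cat // => /andP[/eqP -> /eqP[->]]; by [].
Qed.

Lemma segment_uniq (s : seq vertex) : segment l s -> uniq s.
Proof.
case/and3P => _ _; apply: contraTT => ns.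
apply/negP => so; move/negP: ns; apply.
have : sorted (relpre ct (fun x y : int => x < y)) s.
  by apply: sub_sorted so => x y /ct_step; rewrite /= => ->; lia.
apply: sorted_uniq => [y x z /=|x /=]; [exact: lt_trans|exact: ltxx].
Qed.

Lemma segment_cat (s : seq vertex) a b : segment l s -> s = a ++ b ->
  (a != [::] -> segment l a) /\ (b != [::] -> segment l b).
Proof.
move=> + E; rewrite E /segment all_cat => /and3P[_ /andP[-> ->] so].
have [sa sb] : sorted se_step a /\ sorted se_step b.
  case: a {E} so => [|x a] //=; rewrite cat_path => /andP[-> sb]; split=> //.
  exact: path_sorted sb.
by rewrite sa sb; split=> ->.
Qed.

Lemma segment_step (s : seq vertex) a v w b : segment l s -> s = a ++ v :: w :: b -> se_step v w.
Proof.
move=> sg E; have [_ /(_ isT)] := segment_cat sg E.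
by case/and3P => _ _ /= /andP[].
Qed.

Lemma segment_interior (s : seq vertex) v : segment l s -> v \in s -> interior_vertex l v.
Proof. by case/and3P => _ /allP sI _ /sI. Qed.

Lemma infix_in (s : seq vertex) a v b w : uniq s -> s = a ++ v :: b ->
  infix [:: w; v] s = (a != [::]) && (last v a == w).
Proof.
move=> us E; apply/idP/idP.
  case/infixP => a' [b' E']; have E2 : s = rcons a' w ++ v :: b' by rewrite E' cat_rcons.
  have [||-> _] := @uniq_split _ a (rcons a' w) b b' v; rewrite -?E //.
  by rewrite last_rcons eqxx andbT; case: (a').
case: (lastP a) E => [|a' u] // E; rewrite last_rcons => /andP[_ /eqP <-].
by apply/infixP; exists a', b; rewrite E cat_rcons.
Qed.

Lemma infix_out (s : seq vertex) a v b w : uniq s -> s = a ++ v :: b ->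
  infix [:: v; w] s = (b != [::]) && (head v b == w).
Proof.
move=> us E; apply/idP/idP.
  case/infixP => a' [b' E'].
  have [||_ ->] := @uniq_split _ a a' b (w :: b') v; rewrite -?E //.
  by rewrite /= eqxx.
case: b E => [|u b] // E /= /eqP <-.
by apply/infixP; exists a, b; rewrite E.
Qed.

Lemma mem_cat_split (s : seq vertex) v : v \in s -> exists a b, s = a ++ v :: b.
Proof. by case/splitPr => a b; exists a, b. Qed.

Lemma infix_mem (s : seq vertex) v w : infix [:: v; w] s -> (v \in s) && (w \in s).
Proof. by case/infixP => a [b ->]; rewrite !mem_cat !inE !eqxx !orbT. Qed.

Lemma infix_notin (s : seq vertex) v w : v \notin s ->
  (infix [:: w; v] s = false) * (infix [:: v; w] s = false).
Proof.
by move=> vs; split; apply/negP => /infix_mem /andP[H1 H2]; move: vs; rewrite ?H1 ?H2.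
Qed.

Lemma infix_step (s : seq vertex) v w : segment l s -> infix [:: v; w] s -> se_step v w.
Proof. by move=> sg /infixP[a [b E]]; apply: (segment_step sg) E. Qed.

Lemma segment_inflow (s : seq vertex) v : segment l s ->
  (infix [:: west v; v] s + infix [:: north v; v] s + (initial s == v))%N = (v \in s).
Proof.
move=> sg; have us := segment_uniq sg; have [vs|vs] := boolP (v \in s); last first.
  rewrite !(infix_notin _ vs).
  case: eqP => // E; move: vs; rewrite -E; case: (s) sg => [|x s'] //.
  by rewrite /= mem_head.
have [a [b E]] := mem_cat_split vs.
rewrite !(infix_in _ us E); case: (lastP a) E => [|a' u] E.
  by rewrite E /initial /= eqxx.
rewrite last_rcons; have -> : (rcons a' u != [::]) by case: (a').
have su : se_step u v by apply: (segment_step sg); rewrite E cat_rcons.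
have -> : (initial s == v) = false.
  apply/eqP => E'; move: us; rewrite E cat_uniq => /and3P[_ /hasPn /(_ v)].
  rewrite mem_head -E' E; case: (a') => [|y a''] /=; by rewrite mem_head => /(_ isT).
by move: su; rewrite se_stepP => /orP[] /eqP ->; rewrite eqxx ?(negPf (west_neq_north v)) // eq_sym (negPf (west_neq_north v)).
Qed.

Lemma segment_outflow (s : seq vertex) v : segment l s ->
  (infix [:: v; east v] s + infix [:: v; south v] s + (terminal s == v))%N = (v \in s).
Proof.
move=> sg; have us := segment_uniq sg; have [vs|vs] := boolP (v \in s); last first.
  rewrite !(infix_notin _ vs).
  case: eqP => // E; move: vs; rewrite -E; case: (s) sg => [|x s'] //.
  by rewrite /terminal /= mem_last.
have [a [b E]] := mem_cat_split vs.
rewrite !(infix_out _ us E); case: b E => [|u b] E.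
  by rewrite E /terminal last_cat /= eqxx.
have su : se_step v u by apply: (segment_step sg) E.
have -> : (terminal s == v) = false.
  apply/eqP => E'; move: us; rewrite E cat_uniq => /and3P[_ _ /= /andP[]].
  by rewrite -E' E /terminal last_cat /= mem_last.
by case/orP: su => /eqP -> /=; rewrite eqxx ?(negPf (south_neq_east v)) // eq_sym (negPf (south_neq_east v)).
Qed.

Lemma initial_mem (s : seq vertex) : segment l s -> initial s \in s.
Proof. by case: s => // x s _; rewrite mem_head. Qed.

Lemma terminal_mem (s : seq vertex) : segment l s -> terminal s \in s.
Proof. by case: s => // x s _; rewrite /terminal /= mem_last. Qed.

Lemma segment_ct_head (s : seq vertex) v : segment l s -> v \in s -> ct (initial s) <= ct v.
Proof.
case: s => // x s /and3P[_ _ /= so]; rewrite /initial /= inE => /orP[/eqP->//|].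
elim: s x so => [|y s IH] x //= /andP[/ct_step st so].
rewrite inE => /orP[/eqP->|/(IH _ so)]; lia.
Qed.

Lemma card_fset_filter (T : choiceType) (X : {fset T}) (P : pred T) :
  #|` [fset s in X | P s]%fset| = count P X.
Proof.
rewrite -size_filter; apply/eqP; rewrite -uniq_size_uniq ?fset_uniq ?filter_uniq ?fset_uniq //.
by move=> x; rewrite mem_filter !inE andbC.
Qed.

Lemma count_sum (T : eqType) (X : seq T) (P1 P2 P3 Q : pred T) :
  (forall s, s \in X -> (P1 s + P2 s + P3 s)%N = Q s) ->
  (count P1 X + count P2 X + count P3 X)%N = count Q X.
Proof.
elim: X => [|x X IH] //= H; rewrite -IH => [|s sX]; last by apply: H; rewrite inE sX orbT.
by rewrite -H ?mem_head //; lia.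
Qed.

Lemma count_unique (T U : eqType) (X : seq T) (f : T -> U) v : uniq X ->
  {in X &, forall s t, f s = v -> f t = v -> s = t} ->
  count (fun s => f s == v) X = has (fun s => f s == v) X.
Proof.
elim: X => [|x X IH] //= /andP[xX uX] H; rewrite IH //; last first.
  by move=> s t sX tX; apply: H; rewrite inE ?sX ?tX orbT.
case: eqP => // E /=; case: hasP => // -[y yX /eqP Ey].
by move: xX; rewrite (H x y) ?mem_head ?inE ?yX ?orbT.
Qed.

Definition segments (X : {fset seq vertex}) := forall s, s \in X -> segment l s.
(** Starters and closers only record whether some segment begins or ends at a vertex; under this
    condition they also count such segments, as balance demands. *)
Definition distinct_ends (X : {fset seq vertex}) :=
  {in X &, injective initial} /\ {in X &, injective terminal}.

Lemma flow_int (a b c d s t n : nat) : (a + b + s)%N = n -> (c + d + t)%N = n ->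
  (a + b)%N%:Z - (c + d)%N%:Z = t%:Z - s%:Z.
Proof. by lia. Qed.

Lemma balanced_data_of X : segments X -> distinct_ends X -> balanced l (data_of X).
Proof.
move=> sX [iX tX]; split=> [v w|v|v vI] /=.
- rewrite card_fset_filter -lt0n -has_count => /hasP[s /sX sg vw].
  have /andP[vs ws] := infix_mem vw.
  by rewrite (segment_interior sg vs) (segment_interior sg ws) (infix_step sg vw).
- by case/orP => /hasP[s /sX sg /eqP <-]; apply: (segment_interior sg); rewrite ?initial_mem ?terminal_mem.
rewrite !card_fset_filter.
have H1 := count_sum (fun s sx => segment_inflow v (sX s sx)).
have H2 := count_sum (fun s sx => segment_outflow v (sX s sx)).
rewrite !count_unique ?fset_uniq // in H1 H2; last 2 first.
- by move=> s t sx tx E E'; apply: tX; rewrite // E.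
- by move=> s t sx tx E E'; apply: iX; rewrite // E.
exact: flow_int H1 H2.
Qed.

(** Conservation without subtraction and at every vertex: outside the interior all terms vanish. *)
Lemma balanced_flow D v : balanced l D ->
  (weight D (west v) v + weight D (north v) v + starter D v =
   weight D v (east v) + weight D v (south v) + closer D v)%N.
Proof.
case=> [B1 B2 B3]; have [vI|vI] := boolP (interior_vertex l v); first by have := B3 v vI; lia.
have w1 u : weight D u v = 0%N by apply/eqP; apply: contraNT vI => /B1 /and3P[].
have w2 u : weight D v u = 0%N by apply/eqP; apply: contraNT vI => /B1 /and3P[].
have := B2 v; rewrite !w1 !w2 (negPf vI); case: (starter D v); case: (closer D v) => // H; by have := H isT.
Qed.

Lemma weight_interior D v w : balanced l D -> weight D v w != 0%N ->
  interior_vertex l v /\ interior_vertex l w.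
Proof. by case=> B1 _ _ /B1 /and3P[]. Qed.

End Segments.

(** * Strands routed from balanced data *)

(** The empty [a] satisfies every direction, just as starting with a subsegment does in the
    definition of friendliness. *)
Definition enters (dir : vertex -> vertex) (a : seq vertex) (x : vertex) : bool :=
  (a == [::]) || (last x a == dir x).
Definition exits (dir : vertex -> vertex) (y : vertex) (b : seq vertex) : bool :=
  (b == [::]) || (head y b == dir y).

(* The order West < start < North on paths ending at the same vertex; x :: u is
   their common tail. *)
Definition precedes (p q : seq vertex) : Prop := exists a b x u,
  [/\ p = a ++ x :: u, q = b ++ x :: u, enters west a x, enters north b x & p <> q].

Lemma precedes_rcons p q v : precedes p q -> precedes (rcons p v) (rcons q v).
Proof.
case=> a [b [x [u [-> -> ea eb ne]]]]; exists a, b, x, (rcons u v).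
rewrite !rcons_cat; split=> // E; apply: ne.
by move: E; rewrite -!rcons_cat => /rcons_inj[].
Qed.

Lemma cat_longer_tail (T : Type) (a a' u u' : seq T) x x' : a ++ x :: u = a' ++ x' :: u' ->
  (size u < size u')%N -> a = a' ++ x' :: take (size u' - size u).-1 u'.
Proof.
move=> E lt; have sz : (size a = size a' + (size u' - size u).-1.+1)%N.
  by have := congr1 size E; rewrite !size_cat /=; lia.
have := congr1 (take (size a)) E; rewrite take_size_cat // => {1}->.
by rewrite take_cat sz ltnNge leq_addr /= addKn.
Qed.

Lemma precedes_size a b a' b' x x' u u' :
  a ++ x :: u = a' ++ x' :: u' -> b ++ x :: u = b' ++ x' :: u' ->
  (size u < size u')%N -> enters west a x -> enters north b x -> False.
Proof.
move=> E E' lt; rewrite (cat_longer_tail E lt) (cat_longer_tail E' lt) /enters.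
rewrite !last_cat /=; case: (a') => [|? ?]; case: (b') => [|? ?] /= /eqP -> /eqP /eqP;
by rewrite (negPf (west_neq_north x)).
Qed.

(** If the two decompositions had tails of different lengths, both paths would enter the first
    vertex of the shorter tail from the same neighbour, against West and North. With equal tails
    each prefix enters [x] both from West and from North, hence is empty, and the paths agree. *)
Lemma precedes_anti p q : precedes p q -> precedes q p -> False.
Proof.
case=> a [b [x [u [Ep Eq ea eb ne]]]] [b' [a' [x' [u' [Eq' Ep' eb' ea' _]]]]].
rewrite Ep in Ep'; rewrite Eq in Eq'.
have [lt|lt|eq] := ltngtP (size u) (size u').
- exact: precedes_size Ep' Eq' lt ea eb.
- exact: precedes_size (esym Eq') (esym Ep') lt eb' ea'.
have sa : size a = size a' by have := congr1 size Ep'; rewrite !size_cat /=; slia.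
have sb : size b = size b' by have := congr1 size Eq'; rewrite !size_cat /=; slia.
move/eqP: Ep'; rewrite eqseq_cat // => /andP[/eqP Ea /eqP[Ex _]].
move/eqP: Eq'; rewrite eqseq_cat // => /andP[/eqP Eb _].
subst a' b' x'; apply: ne; rewrite Ep Eq; congr cat.
have E c : enters west c x -> enters north c x -> c = [::].
  case: c => // ? ? /=; rewrite /enters /= => /eqP -> /eqP /eqP.
  by rewrite (negPf (west_neq_north x)).
by rewrite (E a ea ea') (E b eb' eb).
Qed.

Section Slices.
Variables (T : eqType) (f : T -> nat).

(** Applied to exit ranks, this turns slices cut off by length into classes of strands with the same
    exit. *)
Lemma filter_rank (L : seq T) : pairwise (fun x y => f x <= f y)%N L ->
  (forall x, x \in L -> (f x <= 2)%N) ->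
  L = [seq x <- L | f x == 0%N] ++ [seq x <- L | f x == 1%N] ++ [seq x <- L | f x == 2%N].
Proof.
elim: L => [|x L IH] //= /andP[xL pL] b2.
have {}IH := IH pL (fun y yL => b2 y (mem_behead (s := x :: L) yL)).
have none k : (k < f x)%N -> [seq y <- L | f y == k] = [::].
  move=> kx; apply/eqP; rewrite -(negbK (_ == _)) -has_filter; apply/hasPn => y yL.
  by have /allP/(_ y yL) := xL; lia.
have := b2 x (mem_head _ _).
case E: (f x) => [|[|[|//]]] _ /=.
- by rewrite {1}IH.
- by rewrite {1}IH (none 0%N) ?E.
- by rewrite {1}IH (none 0%N) ?(none 1%N) ?E.
Qed.

Lemma take_rank (L : seq T) : pairwise (fun x y => f x <= f y)%N L ->
  (forall x, x \in L -> (f x <= 2)%N) ->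
  take (count (fun x => f x == 0%N) L) L = [seq x <- L | f x == 0%N].
Proof. by move=> pL b2; rewrite {2}(filter_rank pL b2) take_size_cat // size_filter. Qed.

Lemma drop_rank (L : seq T) n : pairwise (fun x y => f x <= f y)%N L ->
  (forall x, x \in L -> (f x <= 2)%N) ->
  size L = (n + count (fun x => f x == 2%N) L)%N ->
  drop n L = [seq x <- L | f x == 2%N].
Proof.
move=> pL b2 sz; rewrite {1}(filter_rank pL b2) catA drop_size_cat //.
have := congr1 size (filter_rank pL b2); rewrite !size_cat !size_filter sz; lia.
Qed.
End Slices.

Section Strands.
Variables (l : grid_shape) (D : twist_data) (o : bool).
Hypothesis balD : balanced l D.
Variable k0 : int.
Hypothesis hk0 : forall v, interior_vertex l v -> k0 < ct v.

(** With [o] true the strands at [v] are cut into East, closing and South parts, with [o] false into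
    South, closing and East parts; the cuts use only the numbers in [D]. *)
Definition first_len v := if o then weight D v (east v) else weight D v (south v).
Definition slice0 v (L : seq (seq vertex)) := take (first_len v) L.
Definition slice1 v (L : seq (seq vertex)) := take (closer D v) (drop (first_len v) L).
Definition slice2 v (L : seq (seq vertex)) := drop (first_len v + closer D v) L.
Definition east_slice v L := if o then slice0 v L else slice2 v L.
Definition south_slice v L := if o then slice2 v L else slice0 v L.

Definition gather v L L' : seq (seq vertex) :=
  [seq rcons p v | p <- east_slice (west v) L] ++ nseq (starter D v) [:: v] ++
  [seq rcons p v | p <- south_slice (north v) L'].

(* The paths from a starter to v, in the order [precedes]; the recursion stops
   because no interior vertex lies on or below the diagonal k0. *)
Fixpoint strands_rec n v : seq (seq vertex) :=
  if n is n'.+1 then gather v (strands_rec n' (west v)) (strands_rec n' (north v))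
  else [::].

Definition strands v := strands_rec `|ct v - k0|.+1 v.

Lemma slice_nil v : (east_slice v [::] = [::]) * (south_slice v [::] = [::]).
Proof. by rewrite /east_slice /south_slice /slice0 /slice2 /=; case: o. Qed.

Lemma starter_interior v : starter D v -> interior_vertex l v.
Proof. by case: balD => _ B2 _ S; apply: B2; rewrite S. Qed.
Lemma closer_interior v : closer D v -> interior_vertex l v.
Proof. by case: balD => _ B2 _ S; apply: B2; rewrite S orbT. Qed.

Lemma starter_low v : ct v <= k0 -> starter D v = false.
Proof. by move=> le; apply/negP => /starter_interior/hk0; lia. Qed.

Lemma strands_low n v : ct v <= k0 -> strands_rec n v = [::].
Proof.
elim: n v => [|n IH] v //= le.
by rewrite !IH ?ctE ?/gather ?slice_nil ?starter_low //=; lia.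
Qed.

Lemma strandsE v : strands v = gather v (strands (west v)) (strands (north v)).
Proof.
have [le|lt] := lerP (ct v) k0.
  by rewrite /strands !strands_low ?/gather ?slice_nil ?starter_low ?ctE //; lia.
rewrite {1}/strands /=; congr gather; rewrite /strands ctE; congr strands_rec; lia.
Qed.

Lemma diag_ind (P : vertex -> Prop) : (forall v, ct v <= k0 -> P v) ->
  (forall v, P (west v) -> P (north v) -> P v) -> forall v, P v.
Proof.
move=> P0 PS v; have [n] := ubnP (absz (ct v - k0)); elim: n v => [|n IH] v // lt.
have [le|gt] := lerP (ct v) k0; first exact: P0.
by apply: PS; apply: IH; rewrite ctE; lia.
Qed.

Lemma strands_base v : ct v <= k0 -> strands v = [::].
Proof. exact: strands_low. Qed.

Definition inflow v := (weight D (west v) v + weight D (north v) v + starter D v)%N.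

Lemma inflowE v : inflow v = (weight D v (east v) + weight D v (south v) + closer D v)%N.
Proof. exact: balanced_flow balD. Qed.

(** Balance at [v] makes the lengths fit: the inflow is exactly the sum of the three parts. *)
Lemma slice_sizes v L : size L = inflow v ->
  [/\ size (east_slice v L) = weight D v (east v),
      size (south_slice v L) = weight D v (south v) & size (slice1 v L) = closer D v].
Proof.
rewrite inflowE /east_slice /south_slice /slice1 /slice0 /slice2 /first_len => E.
by case: o; split; rewrite ?size_take ?size_drop; try case: ifP; lia.
Qed.

Lemma weight_low v w : ct v <= k0 -> weight D v w = 0%N.
Proof.
by move=> le; apply/eqP/negPn/negP => /(weight_interior balD) [/hk0]; lia.
Qed.

Lemma size_strands v : size (strands v) = inflow v.
Proof.
elim/diag_ind: v => [v le|v IHw IHn].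
  by rewrite strands_base // /inflow !weight_low ?starter_low ?ctE //; lia.
have [Ew _ _] := slice_sizes IHw; have [_ En _] := slice_sizes IHn.
by rewrite strandsE /gather !size_cat !size_map size_nseq Ew En westK northK /inflow; lia.
Qed.

Lemma size_slices v :
  [/\ size (east_slice v (strands v)) = weight D v (east v),
      size (south_slice v (strands v)) = weight D v (south v)
    & size (slice1 v (strands v)) = closer D v].
Proof. exact/slice_sizes/size_strands. Qed.

Lemma slices_cat v L : slice0 v L ++ slice1 v L ++ slice2 v L = L.
Proof.
by rewrite /slice1 /slice2 addnC -drop_drop cat_take_drop /slice0 cat_take_drop.
Qed.

Lemma slice_sub v L : {subset east_slice v L <= L} * {subset south_slice v L <= L}
   * {subset slice1 v L <= L}.
Proof.
have E p : p \in L = [|| p \in slice0 v L, p \in slice1 v L | p \in slice2 v L].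
  by rewrite -{1}(slices_cat v L) !mem_cat.
rewrite /east_slice /south_slice; split; first split; move=> p; rewrite E; try case: o;
  by move=> ->; rewrite ?orbT.
Qed.

Lemma strandP v q : reflect
  [\/ q = [:: v] /\ starter D v,
      exists2 p, q = rcons p v & p \in east_slice (west v) (strands (west v))
    | exists2 p, q = rcons p v & p \in south_slice (north v) (strands (north v))]
  (q \in strands v).
Proof.
have -> : (q \in strands v) = (q \in gather v (strands (west v)) (strands (north v))).
  by rewrite -strandsE.
rewrite /gather !mem_cat mem_nseq; apply: (iffP or3P) => [] [].
- by case/mapP => p ? ->; constructor 2; exists p.
- by case/andP; case: (starter D v) => // _ /eqP ->; constructor 1; split.
- by case/mapP => p ? ->; constructor 3; exists p.
- by case=> -> ->; constructor 2; rewrite eqxx.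
- by case=> p -> pL; constructor 1; apply: map_f.
- by case=> p -> pL; constructor 3; apply: map_f.
Qed.

Lemma slice_interior v q : 
  (q \in east_slice v (strands v) -> interior_vertex l v /\ interior_vertex l (east v)) *
  (q \in south_slice v (strands v) -> interior_vertex l v /\ interior_vertex l (south v)) *
  (q \in slice1 v (strands v) -> interior_vertex l v /\ closer D v).
Proof.
have [Se Ss Sc] := size_slices v; split; first split.
- by case: (east_slice _ _) Se => // ? ? /= E _; apply: (weight_interior balD); rewrite -E.
- by case: (south_slice _ _) Ss => // ? ? /= E _; apply: (weight_interior balD); rewrite -E.
- case: (slice1 _ _) Sc => // ? ? /= E _; have C : closer D v by case: (closer D v) E.
  by split=> //; apply: closer_interior.
Qed.

Lemma strand_segment v q : q \in strands v -> segment l q /\ last (0, 0) q = v.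
Proof.
elim/diag_ind: v q => [v /strands_base -> //|v IHw IHn q].
have step p u : segment l p -> last (0, 0) p = u -> interior_vertex l v -> se_step u v ->
    segment l (rcons p v) /\ last (0, 0) (rcons p v) = v.
  rewrite last_rcons /segment all_rcons => /and3P[p0 pi ps] pl vI uv; split=> //.
  rewrite vI pi; apply/andP; split; first by case: (p).
  by case: p p0 pi ps pl => // x p _ _ /= ps pl; rewrite rcons_path ps pl.
case/strandP => [[-> /starter_interior vI]|[p -> pE]|[p -> pS]].
- by rewrite /segment /= vI.
- have [pp pl] := IHw _ ((slice_sub _ _).1.1 _ pE).
  have [_] := (slice_interior _ _).1.1 pE; rewrite westK => vI.
  by apply: (step p (west v)) => //; rewrite /se_step westK eqxx orbT.
- have [pp pl] := IHn _ ((slice_sub _ _).1.2 _ pS).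
  have [_] := (slice_interior _ _).1.2 pS; rewrite northK => vI.
  by apply: (step p (north v)) => //; rewrite /se_step northK eqxx.
Qed.

Lemma uniq_slices v L : uniq L -> uniq (east_slice v L) && uniq (south_slice v L).
Proof.
rewrite -{1}(slices_cat v L) !cat_uniq => /and5P[u0 _ _ _ u2].
by rewrite /east_slice /south_slice; case: o; rewrite u0 u2.
Qed.

Lemma uniq_strands v : uniq (strands v).
Proof.
elim/diag_ind: v => [v /strands_base -> //|v IHw IHn].
rewrite strandsE /gather !cat_uniq !map_inj_uniq; try exact: rcons_injl.
have /andP[-> _] := uniq_slices (west v) IHw; have /andP[_ ->] := uniq_slices (north v) IHn.
rewrite andbT /=; apply/and3P; split.
- apply/hasPn => q; rewrite mem_cat mem_nseq => /orP[/andP[_ /eqP ->]|/mapP[p pS ->]].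
    apply/mapP => -[p /(slice_sub _ _).1.1/strand_segment[+ _]].
    by case: p => [|x [|y p]].
  apply/mapP => -[p' /(slice_sub _ _).1.1/strand_segment[_ pl] E].
  have [_] := strand_segment ((slice_sub _ _).1.2 _ pS).
  have -> : p = p' by move/rcons_inj: E => [].
  rewrite pl => /eqP.
  by rewrite (negPf (west_neq_north v)).
- by case: (starter D v).
apply/hasPn => q /mapP[p /(slice_sub _ _).1.2/strand_segment[pp _] ->].
rewrite mem_nseq; case: (starter D v) => //=; apply/eqP; by case: p pp => [|x [|y p]].
Qed.

Lemma pairwise_slices (r : rel (seq vertex)) v L : pairwise r L ->
  pairwise r (east_slice v L) && pairwise r (south_slice v L).
Proof.
rewrite -{1}(slices_cat v L) !pairwise_cat => /and3P[_ p0 /and3P[_ _ p2]].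
by rewrite /east_slice /south_slice; case: o; rewrite p0 p2.
Qed.

(** The order is built into [gather]: strands from the West, the new one, strands from the North.
    Strands sharing the last edge keep the order they had one diagonal earlier. *)
Lemma strands_sorted v : pairwise (fun p q => `[< precedes p q >]) (strands v).
Proof.
elim/diag_ind: v => [v /strands_base -> //|v IHw IHn].
have mp L : pairwise (fun p q => `[< precedes p q >]) L ->
    pairwise (fun p q => `[< precedes p q >]) [seq rcons p v | p <- L].
  rewrite pairwise_map; apply: sub_pairwise => p q /asboolP H.
  by apply/asboolP/precedes_rcons.
have /andP[/mp PE _] := pairwise_slices (west v) IHw.
have /andP[_ /mp PS] := pairwise_slices (north v) IHn.
have W p : p \in east_slice (west v) (strands (west v)) ->
    p != [::] /\ enters west p v.
  case/(slice_sub _ _).1.1/strand_segment; case: p => // x p _ /= E.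
  by split=> //; rewrite /enters /= E eqxx.
have N p : p \in south_slice (north v) (strands (north v)) ->
    p != [::] /\ enters north p v.
  case/(slice_sub _ _).1.2/strand_segment; case: p => // x p _ /= E.
  by split=> //; rewrite /enters /= E eqxx.
rewrite strandsE /gather !pairwise_cat PE PS /= !andbT.
apply/and3P; split; last by case: (starter D v).
- apply/allrelP => q q' /mapP[p /W[p0 pe] ->].
  rewrite mem_cat mem_nseq => /orP[/andP[_ /eqP ->]|/mapP[p' /N[p'0 pn] ->]]; apply/asboolP.
    exists p, [::], v, [::]; rewrite (cats1 p); split=> //.
    by case: (p) p0 => [|x [|y p1]].
  exists p, p', v, [::]; rewrite !cats1; split=> // /rcons_inj[E]; move: pn pe.
  rewrite -E /enters (negPf p0) => /= /eqP -> /eqP /esym /eqP.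
  by rewrite (negPf (west_neq_north v)).
apply/allrelP => q q'; rewrite mem_nseq => /andP[_ /eqP ->] /mapP[p /N[p0 pn] ->].
apply/asboolP; exists [::], p, v, [::]; rewrite (cats1 p); split=> //.
by case: (p) p0 => [|x [|y p1]].
Qed.

End Strands.

(** * Uniqueness of the routing *)

(* Outgoing strands are ordered East, end, South for o = true (nonfriendly sets)
   and South, end, East for o = false (descent sets). *)
Definition exit_rank (o : bool) (v : vertex) (b : seq vertex) : nat :=
  if b is w :: _ then if (w == east v) == o then 0%N else 2%N else 1%N.

Definition coherent (o : bool) (X : {fset seq vertex}) : Prop :=
  forall v p b p' b', rcons p v ++ b \in X -> rcons p' v ++ b' \in X ->
    precedes (rcons p v) (rcons p' v) -> (exit_rank o v b <= exit_rank o v b')%N.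

Lemma count_pred_bij (T U : eqType) (L : seq T) (M : seq U) (P : pred T) (Q : pred U)
    (f : T -> U) : uniq L -> uniq M ->
  {in [seq x <- L | P x] &, injective f} ->
  (forall y, (y \in M) && Q y <-> exists x, [/\ x \in L, P x & y = f x]) ->
  count P L = count Q M.
Proof.
move=> uL uM fi H; rewrite -!size_filter -(size_map f); apply/eqP.
rewrite -uniq_size_uniq ?map_inj_in_uniq ?filter_uniq // => y.
rewrite mem_filter andbC; apply/idP/idP.
  by case/H => x [xL Px ->]; apply: map_f; rewrite mem_filter Px.
by case/mapP => x; rewrite mem_filter => /andP[Px xL] ->; apply/H; exists x.
Qed.

Section Uniqueness.
Variables (l : grid_shape) (D : twist_data) (o : bool).
Hypothesis balD : balanced l D.
Variable k0 : int.
Hypothesis hk0 : forall v, interior_vertex l v -> k0 < ct v.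
Variable X : {fset seq vertex}.
Hypothesis segX : segments l X.
Hypothesis endX : distinct_ends X.
Hypothesis dataX : same_data (data_of X) D.
Hypothesis cohX : coherent o X.
Notation S := (strands D o k0).

Lemma prefix_unique p b b' : p != [::] -> p ++ b \in X -> p ++ b' \in X -> b = b'.
Proof.
case: p => // x p _ H H'.
have := endX.1 _ _ H H' (erefl _) => /eqP.
by rewrite eqseq_cat // => /andP[_ /eqP].
Qed.

(** Initial vertices being distinct, at most one member of [X] extends a nonempty [p]; the default
    is reached only when none does. *)
Definition continuation p := drop (size p) (head [::] [seq s <- X | prefix p s]).

Lemma continuationE p b : p != [::] -> p ++ b \in X -> continuation p = b.
Proof.
move=> p0 H; rewrite /continuation.
have : p ++ b \in [seq s <- X | prefix p s] by rewrite mem_filter H prefix_prefix.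
case E : [seq s <- X | prefix p s] => [|s r] // _.
have : s \in [seq s <- X | prefix p s] by rewrite E mem_head.
rewrite mem_filter /= => /andP[/prefixP[b' Es] sX].
by rewrite Es drop_size_cat //; apply: (@prefix_unique p) => //; rewrite -Es.
Qed.

Definition strand_of v q := [/\ q != [::], last (0, 0) q = v & exists b, q ++ b \in X].

Lemma strand_ofE v q : strand_of v q -> q ++ continuation q \in X.
Proof. by case=> q0 _ [b H]; rewrite (continuationE q0 H). Qed.

Lemma strand_of_rcons v q : strand_of v q -> exists p, q = rcons p v.
Proof. by case: (lastP q) => [|p x] [] // _; rewrite last_rcons => -> _; exists p. Qed.

Let f v q := exit_rank o v (continuation q).

Lemma weight_count v w : weight D v w = count (infix [:: v; w]) X.
Proof. by case: dataX => E _ _; rewrite -E /= card_fset_filter. Qed.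

Lemma strand_inj v q q' : strand_of v q -> strand_of v q' ->
  q ++ continuation q = q' ++ continuation q' -> q = q'.
Proof.
move=> Hq Hq'; have [p E] := strand_of_rcons Hq; have [p' E'] := strand_of_rcons Hq'.
have := strand_ofE Hq; rewrite E E' !cat_rcons => H Eq.
by have [|-> _] := uniq_split _ Eq; first exact: segment_uniq (segX H).
Qed.

(** Cutting a member of [X] that uses the edge from [v] to [w] right after [v] matches it with the
    strand at [v] leaving along this edge. *)
Lemma count_exit v w n : se_step v w ->
  n = (if (w == east v) == o then 0 else 2)%N ->
  (forall q, q \in S v <-> strand_of v q) ->
  count (fun q => f v q == n) (S v) = weight D v w.
Proof.
move=> vw En HS; rewrite weight_count.
apply: (count_pred_bij (f := fun q => q ++ continuation q)); rewrite ?fset_uniq //.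
- exact: (uniq_strands o balD hk0).
- move=> q q'; rewrite !mem_filter => /andP[_ /HS Hq] /andP[_ /HS Hq'].
  exact: strand_inj Hq Hq'.
move=> s; split=> [/andP[sX /infixP[a [b E]]]|[q [/HS Hq fq ->]]].
  have Es : s = rcons a v ++ w :: b by rewrite cat_rcons.
  have a0 : rcons a v != [::] by case: (a).
  have H : rcons a v ++ w :: b \in X by rewrite -Es.
  exists (rcons a v); split.
  - by apply/HS; split; rewrite ?last_rcons //; exists (w :: b).
  - by rewrite /f (continuationE a0 H) En.
  - by rewrite (continuationE a0 H).
have H := strand_ofE Hq; rewrite H /=.
have [p E] := strand_of_rcons Hq.
move: fq; rewrite /f; case Ec: (continuation q) H => [|u b] H; first by rewrite En; case: ifP.
rewrite En /= => fq; suff -> : w = u.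
  by apply/infixP; exists p, b; rewrite E cat_rcons.
have vu : se_step v u by apply: (segment_step (segX H)); rewrite E cat_rcons.
move: fq; case/orP: vu => /eqP ->; case/orP: vw => /eqP -> //;
  by rewrite ?eqxx (negPf (south_neq_east v)); case: o.
Qed.

(** Strands are sorted by [precedes], so coherence makes their exit ranks nondecreasing; by
    [count_exit] the rank classes have the sizes of the slices. *)
Lemma slices_filter v : (forall q, q \in S v <-> strand_of v q) ->
  [/\ east_slice D o v (S v) = [seq q <- S v | f v q == (if o then 0 else 2)%N]
    & south_slice D o v (S v) = [seq q <- S v | f v q == (if o then 2 else 0)%N]].
Proof.
move=> HS.
have b2 q : q \in S v -> (f v q <= 2)%N.
  by move=> _; rewrite /f /exit_rank; case: continuation => // ? ?; case: ifP.
have so : pairwise (fun x y => f v x <= f v y)%N (S v).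
  have := strands_sorted o balD hk0 v; apply: (sub_in_pairwise (P := mem (S v))); last by apply/allP.
  move=> q q' /HS Hq /HS Hq' /asboolP; have := strand_ofE Hq; have := strand_ofE Hq'.
  have [p Ep] := strand_of_rcons Hq; have [p' Ep'] := strand_of_rcons Hq'.
  by rewrite /f Ep Ep' => H' H; apply: cohX.
have ce := @count_exit v (east v) _ _ (erefl _) HS.
have cs := @count_exit v (south v) _ _ (erefl _) HS.
have ve : se_step v (east v) by rewrite /se_step eqxx orbT.
have vs : se_step v (south v) by rewrite /se_step eqxx.
have {}ce := ce ve; have {}cs := cs vs.
rewrite eqxx (negPf (south_neq_east v)) in ce cs.
have sz := size_strands o balD hk0 v; rewrite (inflowE balD) in sz.
rewrite /east_slice /south_slice /slice0 /slice2 /first_len.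
case: {+}o ce cs so b2 sz => /= ce cs so b2 sz; split.
- by rewrite -ce take_rank.
- by apply: drop_rank => //; rewrite sz cs; lia.
- by apply: drop_rank => //; rewrite sz ce; lia.
- by rewrite -cs take_rank.
Qed.

(** Induction over diagonals: once the lists West and North of [v] are the true initial pieces of
    members of [X], their slices are the true exits, and the list gathered at [v] is true as
    well. *)
Lemma mem_strands v q : q \in S v <-> strand_of v q.
Proof.
have memI u p b : p ++ b \in X -> u \in p -> interior_vertex l u.
  by move=> H up; apply: (segment_interior (segX H)); rewrite mem_cat up.
elim/(@diag_ind k0): v q => [v le q|v IHw IHn q].
  rewrite (strands_base o balD hk0) //; split=> // -[q0 ql [b /memI H]].
  suff /H/hk0 : v \in q by lia.
  by rewrite -ql; case: (q) q0 => // x q1 _; rewrite /= mem_last.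
have [ew _] := slices_filter IHw; have [_ sn] := slices_filter IHn.
have [_ stX _] := dataX.
split.
  case/(strandP o balD hk0) => [[-> st]|[p ->]|[p ->]].
  - move: st; rewrite -stX /= => /hasP[s sX /eqP E]; split=> //.
    exists (behead s); suff -> : [:: v] ++ behead s = s by [].
    by have := segX sX; move: E; case: (s) => // x s' <-.
  - rewrite ew mem_filter => /andP[fp /IHw Hp]; have H := strand_ofE Hp.
    split; rewrite ?last_rcons //; first by case: (p).
    have [p1 E] := strand_of_rcons Hp.
    move: fp; rewrite /f; case Ec : (continuation p) H => [|u b] H; first by case: {+}o.
    rewrite /exit_rank => fu; exists b; rewrite cat_rcons; suff <- : u = v by [].
    have vu : se_step (west v) u by apply: (segment_step (segX H)); rewrite E cat_rcons.
    move: fu; case/orP: vu => /eqP ->; rewrite ?westK //.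
    by rewrite -{2}(westK v) (negPf (south_neq_east _)); case: {+}o.
  - rewrite sn mem_filter => /andP[fp /IHn Hp]; have H := strand_ofE Hp.
    split; rewrite ?last_rcons //; first by case: (p).
    have [p1 E] := strand_of_rcons Hp.
    move: fp; rewrite /f; case Ec : (continuation p) H => [|u b] H; first by case: {+}o.
    rewrite /exit_rank => fu; exists b; rewrite cat_rcons; suff <- : u = v by [].
    have vu : se_step (north v) u by apply: (segment_step (segX H)); rewrite E cat_rcons.
    by move: fu; case/orP: vu => /eqP ->; rewrite ?northK // eqxx; case: {+}o.
move=> Hq; have [p Eq] := strand_of_rcons Hq; have [q0 _ [b H]] := Hq.
apply/(strandP o balD hk0); case: (lastP p) Eq => [|p1 u] Eq.
  constructor 1; rewrite Eq; split=> //; rewrite -stX /=; apply/hasP.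
  by exists (q ++ b) => //; rewrite Eq.
have uv : se_step u v by apply: (segment_step (segX H)); rewrite Eq !cat_rcons.
have H1 : rcons p1 u ++ v :: b \in X by rewrite -cat_rcons -Eq.
have p0 : rcons p1 u != [::] by case: (p1).
have Hu : strand_of u (rcons p1 u) by split; rewrite ?last_rcons //; exists (v :: b).
have fu : f u (rcons p1 u) = if (v == east u) == o then 0%N else 2%N.
  by rewrite /f (continuationE p0 H1).
move: uv; rewrite se_stepP => /orP[] /eqP Eu; subst u.
- constructor 3; exists (rcons p1 (north v)) => //; rewrite sn mem_filter fu.
  rewrite -{1}(northK v) (negPf (south_neq_east _)).
  by apply/andP; split; [case: {+}o|apply/IHn].
- constructor 2; exists (rcons p1 (west v)) => //; rewrite ew mem_filter fu westK eqxx.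
  by apply/andP; split; [case: {+}o|apply/IHw].
Qed.

(** The right-hand side does not mention [X], so coherent sets with data [D] coincide. *)
Lemma mem_coherent s :
  (s \in X) = (s != [::]) && (s \in slice1 D o (last (0, 0) s) (S (last (0, 0) s))).
Proof.
have [->|s0] := eqVneq s [::]; first by apply/negP => /segX.
set v := last _ s; have [ew sn] := slices_filter (@mem_strands v).
have H : (s \in slice1 D o v (S v)) = (s \in S v) && (f v s == 1%N).
  have us := uniq_strands o balD hk0 v.
  have fs : (s \in east_slice D o v (S v)) || (s \in south_slice D o v (S v)) =
     (s \in S v) && (f v s != 1%N).
    rewrite ew sn !mem_filter -andb_orl andbC; congr andb.
    rewrite /f /exit_rank; case: continuation => [|? ?]; case: {+}o => //; by case: ifP.
  have fs2 : (s \in east_slice D o v (S v)) || (s \in south_slice D o v (S v)) =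
     (s \in slice0 D o v (S v)) || (s \in slice2 D o v (S v)).
    by rewrite /east_slice /south_slice; case: {+}o => //; rewrite orbC.
  have mS : (s \in S v) = [|| s \in slice0 D o v (S v), s \in slice1 D o v (S v)
                             | s \in slice2 D o v (S v)].
    by rewrite -!mem_cat slices_cat.
  have := us; rewrite -{1}(slices_cat D o v (S v)) !cat_uniq.
  rewrite fs2 mS in fs; rewrite mS; move: fs.
  set s1 := slice1 _ _ _ _; set s2 := slice2 _ _ _ _; set t0 := slice0 _ _ _ _.
  move=> fs /and3P[_ n0 /and3P[_ n1 _]].
  have d0 : s \in s1 -> s \notin t0 by move=> H; apply: (hasPn n0); rewrite mem_cat H.
  have d1 : s \in s1 -> s \notin s2.
    by move=> H; apply/negP => /(hasPn n1); rewrite /= H.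
  move: fs d0 d1; case: (s \in s1) => /=; last first.
    by case: (s \in t0); case: (s \in s2); case: eqP.
  by move=> F /(_ isT) /negPf E1 /(_ isT) /negPf E2; move: F; rewrite E1 E2; case: eqP.
rewrite H /=; apply/idP/andP => [sX|[/mem_strands Hs fs]].
  have sX' : s ++ [::] \in X by rewrite cats0.
  rewrite /f (continuationE s0 sX'); split=> //; apply/mem_strands.
  by split=> //; exists [::].
have := strand_ofE Hs; move: fs; rewrite /f; case: continuation => [|? ?]; first by rewrite cats0.
by rewrite /exit_rank; case: ifP.
Qed.

End Uniqueness.

Lemma cells_ct_bounds l : exists k0 k1 : int, forall c, c \in cells l -> k0 < ct c < k1.
Proof.
have [E|/fset0Pn[c0 c0K]] := eqVneq (cells l) fset0; first by exists 0, 0 => c; rewrite E.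
have [x [_ _ mx]] := @seq_argmin _ ct predT (cells l) c0 c0K isT.
have [y [_ _ my]] := @seq_argmin _ (fun c => - ct c) predT (cells l) c0 c0K isT.
by exists (ct x - 1), (ct y + 1) => v vK; have := mx v vK isT; have := my v vK isT; lia.
Qed.

Lemma interior_ct_bounds l : exists k0 k1 : int,
  forall v, interior_vertex l v -> k0 < ct v < k1.
Proof.
have [k0 [k1 hk]] := cells_ct_bounds l; exists k0, k1 => v.
by rewrite interiorE => /and4P[/hk].
Qed.

Lemma coherent_unique l o D X Y : balanced l D ->
  segments l X -> distinct_ends X -> same_data (data_of X) D -> coherent o X ->
  segments l Y -> distinct_ends Y -> same_data (data_of Y) D -> coherent o Y -> X = Y.
Proof.
move=> bD sX eX dX cX sY eY dY cY; have [k0 [k1 hk]] := interior_ct_bounds l.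
have hk0 v : interior_vertex l v -> k0 < ct v by move/hk/andP => [].
by apply/fsetP => s; rewrite (mem_coherent bD hk0 sX eX dX cX) (mem_coherent bD hk0 sY eY dY cY).
Qed.

(** * Nonfriendly sets *)

Section Friendly.
Variable l : grid_shape.

Lemma infix_middle (T : eqType) (a u b : seq T) : infix u (a ++ u ++ b).
Proof. by apply/infixP; exists a, b. Qed.

Lemma uniq_split_infix (T : eqType) (a a' b b' u r : seq T) x : uniq r ->
  r = a ++ (x :: u) ++ b -> r = a' ++ (x :: u) ++ b' -> a = a' /\ b = b'.
Proof.
move=> ur E E'; have [||-> /eqP] := @uniq_split _ a a' (u ++ b) (u ++ b') x.
- by rewrite E in ur.
- by rewrite E in E'.
by rewrite eqseq_cat // => /andP[_ /eqP].
Qed.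

(** A repetition-free sequence contains [x :: u] at one place only, so the prefix, suffix and infix
    tests reduce to the neighbours of that place. *)
Lemma friendly_orderedP s t a b a' b' x u : uniq s -> uniq t ->
  s = a ++ (x :: u) ++ b -> t = a' ++ (x :: u) ++ b' ->
  friendly_ordered s t (x :: u) = [&& enters west a x, exits south (last x u) b,
    enters north a' x & exits east (last x u) b'].
Proof.
have starts r c d : uniq r -> r = c ++ (x :: u) ++ d -> prefix (x :: u) r = (c == [::]).
  move=> ur E; apply/idP/eqP => [/prefixP[d' E']|E0]; last by rewrite E E0 prefix_prefix.
  by have [] := uniq_split_infix ur E (E' : r = [::] ++ _).
have ends r c d : uniq r -> r = c ++ (x :: u) ++ d -> suffix (x :: u) r = (d == [::]).
  move=> ur E; apply/idP/eqP => [/suffixP[c' E']|E0]; last by rewrite E E0 cats0 suffix_suffix.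
  by rewrite -[x :: u]cats0 in E'; have [] := uniq_split_infix ur E E'.
have enter dir r c d : uniq r -> r = c ++ (x :: u) ++ d ->
    enters_from dir r (x :: u) = (c != [::]) && (last x c == dir x).
  move=> ur E; rewrite /enters_from; apply/infixP/andP => [[c' [d' E']]|[]].
    rewrite -[(dir x :: x :: u) ++ d']/(dir x :: ((x :: u) ++ d')) -cat_rcons in E'.
    have [-> _] := uniq_split_infix ur E E'.
    by rewrite last_rcons eqxx; case: (c').
  case: (lastP c) E => // c' z E _; rewrite last_rcons => /eqP <-.
  by exists c', d; rewrite E cat_rcons.
have leave dir r c d : uniq r -> r = c ++ (x :: u) ++ d ->
    leaves_to dir r (x :: u) = (d != [::]) && (head (last x u) d == dir (last x u)).
  move=> ur E; rewrite /leaves_to; apply/infixP/andP => [[c' [d' E']]|[]].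
    rewrite cat_rcons in E'.
    by have [_ ->] := uniq_split_infix ur E E'; rewrite /= eqxx.
  case: d E => // z d E _ /eqP /= <-.
  by exists c, d; rewrite E /= cat_rcons.
move=> us ut Es Et; rewrite /friendly_ordered /starts_with /ends_with.
rewrite (starts _ _ _ us Es) (ends _ _ _ us Es) (starts _ _ _ ut Et) (ends _ _ _ ut Et).
rewrite (enter _ _ _ _ us Es) (leave _ _ _ _ us Es) (enter _ _ _ _ ut Et) (leave _ _ _ _ ut Et).
rewrite /enters /exits.
by case: (a == _); case: (b == _); case: (a' == _); case: (b' == _).
Qed.

Lemma friendly_along_intro s t a b a' b' x u : segment l s -> segment l t ->
  s = a ++ (x :: u) ++ b -> t = a' ++ (x :: u) ++ b' ->
  enters west a x -> exits south (last x u) b ->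
  enters north a' x -> exits east (last x u) b' ->
  friendly_along s t (x :: u) /\ segment l (x :: u).
Proof.
move=> ss st Es Et h1 h2 h3 h4; split; last first.
  have [_ /(_ isT) sg] := segment_cat ss Es.
  by have [/(_ isT)] := segment_cat sg (erefl _).
rewrite /friendly_along {1}Es {1}Et !infix_middle /=.
by rewrite (friendly_orderedP (segment_uniq ss) (segment_uniq st) Es Et) h1 h2 h3 h4.
Qed.

Definition differ_at_head (b b' : seq vertex) : bool :=
  match b, b' with
  | [::], [::] => false | y :: _, z :: _ => y != z | _, _ => true end.

Lemma common_prefix (s t : seq vertex) : s != t -> exists c b b',
  [/\ s = c ++ b, t = c ++ b' & differ_at_head b b'].
Proof.
elim: s t => [|x s IH] [|y t] //=.
- by move=> _; exists [::], [::], (y :: t).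
- by move=> _; exists [::], (x :: s), [::].
have [->|ne _] := eqVneq x y; last by exists [::], (x :: s), (y :: t).
rewrite eqseq_cons eqxx /= => /IH[c [b [b' [-> -> H]]]].
by exists (y :: c), b, b'.
Qed.

Lemma common_suffix (s t : seq vertex) : s != t -> exists c a a',
  [/\ s = a ++ c, t = a' ++ c & differ_at_head (rev a) (rev a')].
Proof.
rewrite -(inj_eq (can_inj revK)) => /common_prefix[c [b [b' [E E' H]]]].
exists (rev c), (rev b), (rev b'); rewrite -!rev_cat -E -E' !revK; split=> //.
Qed.

Variable X : {fset seq vertex}.
Hypothesis nfX : nonfriendly_set l X.

Lemma nonfriendly_segments : segments l X.
Proof. by case: nfX. Qed.

Lemma nonfriendly_absurd s t a b a' b' x u : s \in X -> t \in X -> s != t ->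
  s = a ++ (x :: u) ++ b -> t = a' ++ (x :: u) ++ b' ->
  enters west a x -> exits south (last x u) b ->
  enters north a' x -> exits east (last x u) b' -> False.
Proof.
move=> sX tX st Es Et h1 h2 h3 h4; have [sg nf] := nfX.
have [F U] := friendly_along_intro (sg s sX) (sg t tX) Es Et h1 h2 h3 h4.
by have := nf s t _ sX tX st U; rewrite F.
Qed.

(** If two strands violate the exit order, their segments are friendly along the common tail
    [x :: u] that witnesses [precedes]. *)
Lemma nonfriendly_coherent : coherent true X.
Proof.
move=> v p b p' b' sX tX [a [a' [x [u [E E' ea ea' ne]]]]].
rewrite leqNgt; apply/negP => lt; have sg := nonfriendly_segments.
have lu : last x u = v by have := congr1 (last v) E; rewrite last_rcons last_cat.
have Es : rcons p v ++ b = a ++ (x :: u) ++ b by rewrite E catA.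
have Et : rcons p' v ++ b' = a' ++ (x :: u) ++ b' by rewrite E' catA.
apply: (nonfriendly_absurd sX tX _ Es Et) => //; rewrite ?lu.
- apply/eqP => Est; apply: ne; move: Est; rewrite !cat_rcons => Est.
  have [|-> //] := uniq_split _ Est; rewrite -cat_rcons; exact: segment_uniq (sg _ sX).
- move: lt sX; case: b {Es} => [//|w b] /=; rewrite /exits /=.
  have [->|nw _ sX] := eqVneq w (east v); first by rewrite ltn0.
  have : se_step v w by apply: (segment_step (sg _ sX)); rewrite cat_rcons.
  by rewrite /se_step (negPf nw) orbF.
- move: lt; case: b' {Et tX} => [//|w b'] /=; rewrite /exits /=.
  by case: (w == _) => //=; case: (b) => [|? ?] //=; case: ifP.
Qed.

(** Both segments start with their longest common prefix. However they part, one of them ends there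
    or leaves South while the other ends there or leaves East, so they are friendly along it. *)
Lemma nonfriendly_initial : {in X &, injective initial}.
Proof.
have sg := nonfriendly_segments.
move=> s t sX tX Ei; apply/eqP/negPn/negP => st.
have [c [b [b' [Es Et H]]]] := common_prefix st.
case: c Es Et => [|x u] Es Et.
  move: Ei H (sg _ sX) (sg _ tX); rewrite Es Et /=.
  by case: (b) => // y c; case: (b') => // z c'; rewrite /initial /= => ->; rewrite eqxx.
have Es' : s = [::] ++ (x :: u) ++ b by rewrite Es.
have Et' : t = [::] ++ (x :: u) ++ b' by rewrite Et.
have step r d w : r \in X -> r = (x :: u) ++ w :: d -> se_step (last x u) w.
  move=> rX; rewrite lastI cat_rcons => E; exact: (segment_step (sg _ rX)) E.
have st' : t != s by rewrite eq_sym.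
case: b b' H Es Et Es' Et' => [|y b] [|z b'] // H Es Et Es' Et'.
- case/orP: (step _ _ _ tX Et) => /eqP E.
  + by apply: (nonfriendly_absurd tX sX st' Et' Es'); rewrite /exits /enters //= E eqxx.
  + by apply: (nonfriendly_absurd sX tX st Es' Et'); rewrite /exits /enters //= E eqxx.
- case/orP: (step _ _ _ sX Es) => /eqP E.
  + by apply: (nonfriendly_absurd sX tX st Es' Et'); rewrite /exits /enters //= E eqxx.
  + by apply: (nonfriendly_absurd tX sX st' Et' Es'); rewrite /exits /enters //= E eqxx.
move: H; case/orP: (step _ _ _ sX Es) => /eqP E; case/orP: (step _ _ _ tX Et) => /eqP E';
  rewrite /= {1}E {1}E' ?eqxx // => _.
+ by apply: (nonfriendly_absurd sX tX st Es' Et'); rewrite /exits /enters //= ?E ?E' eqxx.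
+ by apply: (nonfriendly_absurd tX sX st' Et' Es'); rewrite /exits /enters //= ?E ?E' eqxx.
Qed.

Lemma nonfriendly_terminal : {in X &, injective terminal}.
Proof.
have sg := nonfriendly_segments.
move=> s t sX tX Ei; apply/eqP/negPn/negP => st.
have [c [a [a' [Es Et H]]]] := common_suffix st.
case: c Es Et => [|x u] Es Et.
  move: Ei H (sg _ sX) (sg _ tX); rewrite Es Et !cats0 /=.
  case: (lastP a) => [|d y] //.
  case: (lastP a') => [|d' z] //.
  rewrite /terminal !last_rcons !rev_rcons => -> /=.
  by rewrite eqxx.
have Es' : s = a ++ (x :: u) ++ [::] by rewrite cats0.
have Et' : t = a' ++ (x :: u) ++ [::] by rewrite cats0.
have step r d w : r \in X -> r = rcons d w ++ (x :: u) -> (w == north x) || (w == west x).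
  by move=> rX; rewrite cat_rcons => E; rewrite -se_stepP; exact: (segment_step (sg _ rX)) E.
have st' : t != s by rewrite eq_sym.
have en dir d w : w = dir x -> enters dir (rcons d w) x.
  by move=> ->; rewrite /enters last_rcons eqxx orbT.
case: (lastP a) H Es Es' => [|d y] H Es Es'; case: (lastP a') H Et Et' => [|d' z] // H Et Et'.
- case/orP: (step _ _ _ tX Et) => /eqP E.
  + by apply: (nonfriendly_absurd sX tX st Es' Et') => //; apply: en.
  + by apply: (nonfriendly_absurd tX sX st' Et' Es') => //; apply: en.
- case/orP: (step _ _ _ sX Es) => /eqP E.
  + by apply: (nonfriendly_absurd tX sX st' Et' Es') => //; apply: en.
  + by apply: (nonfriendly_absurd sX tX st Es' Et') => //; apply: en.
have ne : y <> z by move=> E; move: H; rewrite !rev_rcons /= E eqxx.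
case/orP: (step _ _ _ sX Es) => /eqP E; case/orP: (step _ _ _ tX Et) => /eqP E'.
+ by case: ne; rewrite E E'.
+ by apply: (nonfriendly_absurd tX sX st' Et' Es') => //; apply: en.
+ by apply: (nonfriendly_absurd sX tX st Es' Et') => //; apply: en.
+ by case: ne; rewrite E E'.
Qed.

Lemma nonfriendly_ends : distinct_ends X.
Proof. by split; [exact: nonfriendly_initial|exact: nonfriendly_terminal]. Qed.

End Friendly.

(** * Existence of a nonfriendly set with given balanced data *)

Section Existence.
Variables (l : grid_shape) (D : twist_data).
Hypothesis balD : balanced l D.
Variables k0 k1 : int.
Hypothesis hk0 : forall v, interior_vertex l v -> k0 < ct v.
Hypothesis hk1 : forall v, interior_vertex l v -> ct v < k1.
Notation S := (strands D true k0).

(** The vertices range over [cells l] because a closer is an interior vertex, so the cell it names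
    lies in the shape. *)
Definition routing : {fset seq vertex} :=
  [fset s in flatten [seq slice1 D true v (S v) | v <- enum_fset (cells l)]]%fset.

Lemma mem_routing s : (s \in routing) <-> exists v, s \in slice1 D true v (S v).
Proof.
rewrite !inE; split=> [/flattenP[L /mapP[v _ ->] sL]|[v sv]]; first by exists v.
apply/flattenP; exists (slice1 D true v (S v)) => //; apply: map_f.
have [vI _] := (slice_interior true balD hk0 _ _).2 sv.
by move: vI; rewrite interiorE => /and4P[].
Qed.

Lemma routing_strand s : s \in routing -> s != [::] /\
  s \in slice1 D true (last (0, 0) s) (S (last (0, 0) s)).
Proof.
case/mem_routing => v sv.
have [sg ->] := strand_segment balD hk0 ((slice_sub _ _ _ _).2 _ sv).
by split=> //; case/and3P: sg.
Qed.

Lemma routing_segments : segments l routing.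
Proof.
move=> s /mem_routing[v sv].
by have [] := strand_segment balD hk0 ((slice_sub _ _ _ _).2 _ sv).
Qed.

Lemma prefix_strand p w b u v : p != [::] -> last (0, 0) p = u -> p ++ w :: b \in S v ->
  (w = east u /\ p \in east_slice D true u (S u)) \/
  (w = south u /\ p \in south_slice D true u (S u)).
Proof.
move=> p0 <-{u}; elim/last_ind: b v => [|b z IH] v.
  rewrite cats1 => /(strandP true balD hk0)[[E _]|[q E H]|[q E H]].
  - by case: (p) p0 E => [|x [|y p']].
  - have [Ep Ew] := rcons_inj E; subst q w; left.
    have [_ ->] := strand_segment balD hk0 ((slice_sub _ _ _ _).1.1 _ H).
    by rewrite westK.
  - have [Ep Ew] := rcons_inj E; subst q w; right.
    have [_ ->] := strand_segment balD hk0 ((slice_sub _ _ _ _).1.2 _ H).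
    by rewrite northK.
rewrite -rcons_cons -rcons_cat => /(strandP true balD hk0)[[E _]|[q E H]|[q E H]].
- by case: (p) p0 E => [|x [|y p']].
- have [Ep Ew] := rcons_inj E; subst q v; exact: IH ((slice_sub _ _ _ _).1.1 _ H).
- have [Ep Ew] := rcons_inj E; subst q v; exact: IH ((slice_sub _ _ _ _).1.2 _ H).
Qed.

Lemma mem_slices v p : (p \in S v) = [|| p \in east_slice D true v (S v),
  p \in slice1 D true v (S v) | p \in south_slice D true v (S v)].
Proof. by rewrite -!mem_cat slices_cat. Qed.

(** A strand outside the closing slice moves on to the next diagonal, and the bound [k1] stops
    this. *)
Lemma routing_extends v p : p \in S v -> exists b, p ++ b \in routing.
Proof.
have [n] := ubnP (absz (k1 - ct v)); elim: n v p => [|n IH] v p // lt.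
have next w : interior_vertex l v -> interior_vertex l w -> ct w = ct v + 1 ->
    rcons p w \in S w -> exists b, p ++ b \in routing.
  move=> /hk1 h1 /hk1 h2 E /(IH w)[|b]; first by move: lt; rewrite E; lia.
  by rewrite cat_rcons; exists (w :: b).
rewrite mem_slices => /or3P[] H.
- have [vI wI] := (slice_interior true balD hk0 _ _).1.1 H.
  apply: (next (east v)) => //; first by rewrite ctE.
  by apply/(strandP true balD hk0); constructor 2; exists p; rewrite ?eastK.
- by exists [::]; rewrite cats0; apply/mem_routing; exists v.
have [vI wI] := (slice_interior true balD hk0 _ _).1.2 H.
apply: (next (south v)) => //; first by rewrite ctE.
by apply/(strandP true balD hk0); constructor 3; exists p; rewrite ?southK.
Qed.

Lemma slices_disjoint v p :
  [/\ p \in east_slice D true v (S v) -> p \in slice1 D true v (S v) -> False,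
      p \in east_slice D true v (S v) -> p \in south_slice D true v (S v) -> False
    & p \in slice1 D true v (S v) -> p \in south_slice D true v (S v) -> False].
Proof.
have := uniq_strands true balD hk0 v.
rewrite -{1}(slices_cat D true v (S v)) !cat_uniq.
move=> /and3P[_ /hasPn n0 /and3P[_ /hasPn n1 _]]; split=> H1 H2.
- by have := n0 p; rewrite mem_cat H2 /= H1 => /(_ isT).
- by have := n0 p; rewrite mem_cat [p \in slice2 _ _ _ _]H2 orbT /= H1 => /(_ isT).
- by have := n1 p H2; rewrite /= H1.
Qed.

Lemma routing_prefix p w b u : p != [::] -> last (0, 0) p = u -> p ++ w :: b \in routing ->
  (w = east u /\ p \in east_slice D true u (S u)) \/
  (w = south u /\ p \in south_slice D true u (S u)).
Proof.
move=> p0 lu /mem_routing[v /(slice_sub _ _ _ _).2 H]; exact: prefix_strand lu H.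
Qed.

(** The slice holding a strand dictates what it does next, and the slices are disjoint. *)
Lemma routing_unique p b b' : p != [::] ->
  p ++ b \in routing -> p ++ b' \in routing -> b = b'.
Proof.
elim: b p b' => [|w b IH] p [|w' b'] // p0.
- rewrite cats0 => /routing_strand[_ H] /routing_prefix - /(_ _ p0 (erefl _)).
  by have [d1 d2 d3] := slices_disjoint (last (0, 0) p) p => -[[_ /d1]|[_ /d3]].
- rewrite cats0 => /routing_prefix - /(_ _ p0 (erefl _)) H' /routing_strand[_ H].
  by move: H'; have [d1 d2 d3] := slices_disjoint (last (0, 0) p) p => -[[_ /d1]|[_ /d3]].
move=> H H'; suff E : w = w'.
  subst w'; congr cons; apply: (IH (rcons p w)); rewrite ?cat_rcons //; by case: (p).
have := routing_prefix p0 (erefl _) H; have := routing_prefix p0 (erefl _) H'.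
have [d1 d2 d3] := slices_disjoint (last (0, 0) p) p.
move=> [[-> h1]|[-> h1]] [[-> h2]|[-> h2]] //; first by case: d2.
by case: d2.
Qed.

Lemma take_index (a c : seq vertex) v : uniq (a ++ v :: c) ->
  take (index v (a ++ v :: c)).+1 (a ++ v :: c) = rcons a v.
Proof.
rewrite cat_uniq => /and3P[_ /norP[/negPf na _] _].
by rewrite index_cat na /= eqxx addn0 -cat_rcons take_size_cat // size_rcons.
Qed.

Lemma routing_weight v w L : se_step v w ->
  (forall p, p \in L <-> p \in S v /\ rcons p w \in S w) -> uniq L ->
  count (infix [:: v; w]) routing = size L.
Proof.
move=> vw HL uL; rewrite -(count_predT L).
apply: (count_pred_bij (f := fun s => take (index v s).+1 s)); rewrite ?fset_uniq //.
  move=> s t; rewrite !mem_filter => /andP[/infixP[a [b Es]] sY] /andP[/infixP[a' [b' Et]] tY].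
  have us := segment_uniq (routing_segments sY); have ut := segment_uniq (routing_segments tY).
  rewrite Es in us sY *; rewrite Et in ut tY *; rewrite !take_index // => /rcons_inj[Ea].
  subst a'; move: sY tY; rewrite -!cat_rcons => sY tY.
  by congr cat; apply: (@routing_unique (rcons (rcons a v) w)) => //; case: (a).
move=> p; rewrite andbT; split.
  move=> /HL[pv pw]; have [b] := routing_extends pw; rewrite cat_rcons => H.
  have [sg lp] := strand_segment balD hk0 pv.
  have Ep : exists a, p = rcons a v.
    by case/and3P: sg; case: (lastP p) lp => // a z; rewrite last_rcons => ->; exists a.
  case: Ep => a Ep; exists (p ++ w :: b); split=> //.
    by rewrite Ep cat_rcons; apply/infixP; exists a, b.
  have us := segment_uniq (routing_segments H).
  by rewrite Ep cat_rcons take_index // -cat_rcons -Ep.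
case=> s [sY /infixP[a [b Es]] ->]; have us := segment_uniq (routing_segments sY).
rewrite Es in us sY *; rewrite take_index //; apply/HL.
have a0 : rcons a v != [::] by case: (a).
have := @routing_prefix (rcons a v) w b v a0; rewrite last_rcons cat_rcons => /(_ (erefl _) sY) [[Ew H]|[Ew H]].
- split; first exact: ((slice_sub _ _ _ _).1.1 _ H).
  by apply/(strandP true balD hk0); constructor 2; exists (rcons a v); rewrite // Ew eastK.
- split; first exact: ((slice_sub _ _ _ _).1.2 _ H).
  by apply/(strandP true balD hk0); constructor 3; exists (rcons a v); rewrite // Ew southK.
Qed.

Lemma last_strand v p : p \in S v -> exists a, p = rcons a v.
Proof.
case/(strand_segment balD hk0); case: (lastP p) => // a z _; rewrite last_rcons => ->.
by exists a.
Qed.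

Lemma mem_strand_east v p : p \in east_slice D true v (S v) <->
  p \in S v /\ rcons p (east v) \in S (east v).
Proof.
split=> [H|[H]]; first split.
- exact: ((slice_sub _ _ _ _).1.1 _ H).
- by apply/(strandP true balD hk0); constructor 2; exists p; rewrite ?eastK.
case/(strandP true balD hk0) => [[E _]|[q E H']|[q E H']].
- by have [a Ea] := last_strand H; move/(congr1 size): E; rewrite Ea !size_rcons.
- by rewrite eastK in H'; case/rcons_inj: E => ->.
case/rcons_inj: E => E; subst q.
have [a Ea] := last_strand H; have [a' Ea'] := last_strand ((slice_sub _ _ _ _).1.2 _ H').
have : v = north (east v) by move: Ea'; rewrite Ea => /rcons_inj[].
by move/(congr1 south); rewrite northK => /eqP; rewrite (negPf (south_neq_east v)).
Qed.

Lemma mem_strand_south v p : p \in south_slice D true v (S v) <->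
  p \in S v /\ rcons p (south v) \in S (south v).
Proof.
split=> [H|[H]]; first split.
- exact: ((slice_sub _ _ _ _).1.2 _ H).
- by apply/(strandP true balD hk0); constructor 3; exists p; rewrite ?southK.
case/(strandP true balD hk0) => [[E _]|[q E H']|[q E H']].
- by have [a Ea] := last_strand H; move/(congr1 size): E; rewrite Ea !size_rcons.
- case/rcons_inj: E => E; subst q.
  have [a Ea] := last_strand H; have [a' Ea'] := last_strand ((slice_sub _ _ _ _).1.1 _ H').
  have : v = west (south v) by move: Ea'; rewrite Ea => /rcons_inj[].
  move/(congr1 east); rewrite westK => /esym /eqP; rewrite (negPf (south_neq_east v)) //.
by rewrite southK in H'; case/rcons_inj: E => ->.
Qed.

Lemma routing_data : same_data (data_of routing) D.
Proof.
have us v := uniq_slices D true v (uniq_strands true balD hk0 v).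
split=> [v w|v|v] /=.
- rewrite card_fset_filter; have [vw|nvw] := boolP (se_step v w); last first.
    transitivity 0%N; last first.
      apply/esym/eqP/negPn/negP; case: balD => B1 _ _ /B1 /and3P[_ _].
      by rewrite (negPf nvw).
    apply/eqP; rewrite -leqn0 leqNgt -has_count; apply/negP => /hasP[s sY] /=.
    by move/(infix_step (routing_segments sY)); rewrite (negPf nvw).
  have /andP[ue us'] := us v; have [ze zs _] := size_slices true balD hk0 v.
  case/orP: (vw) => /eqP E; subst w.
    rewrite (routing_weight vw (@mem_strand_south v)) //.
  by rewrite (routing_weight vw (@mem_strand_east v)).
- apply/hasP/idP => [[s sY /eqP Es]|st].
    have sg := routing_segments sY.
    case: s sY Es sg => [|x s] // sY; rewrite /initial /= => Ex sg; subst x.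
    have : [:: v] \in S v.
      case: s sY {sg} => [|w s] sY.
        by have [_ /(slice_sub _ _ _ _).2] := routing_strand sY.
      have := @routing_prefix [:: v] w s v isT (erefl _) sY.
      by case=> -[_ H]; [apply: ((slice_sub _ _ _ _).1.1 _ H)|apply: ((slice_sub _ _ _ _).1.2 _ H)].
    case/(strandP true balD hk0) => [[_ //]|[q E H]|[q E H]].
    - have [a Ea] := last_strand ((slice_sub _ _ _ _).1.1 _ H).
      by move/(congr1 size): E; rewrite Ea !size_rcons.
    - have [a Ea] := last_strand ((slice_sub _ _ _ _).1.2 _ H).
      by move/(congr1 size): E; rewrite Ea !size_rcons.
  have : [:: v] \in S v by apply/(strandP true balD hk0); constructor 1.
  by case/routing_extends => b H; exists ([:: v] ++ b).
- have [_ _ zc] := size_slices true balD hk0 v.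
  apply/hasP/idP => [[s sY /eqP Es]|st].
    have [_] := routing_strand sY; rewrite -/(terminal s) Es => H.
    by move: zc H; case: (slice1 _ _ _ _) => //; case: (closer D v).
  case E : (slice1 D true v (S v)) zc => [|s L]; first by rewrite st.
  move=> _; have sv : s \in slice1 D true v (S v) by rewrite E mem_head.
  exists s; first by apply/mem_routing; exists v.
  have [_ ls] := strand_segment balD hk0 ((slice_sub _ _ _ _).2 _ sv).
  by rewrite /terminal ls.
Qed.

(** Friendliness makes [p] precede [q], although [p] closes or leaves South and [q] closes or leaves
    East. The slices list these exits in the opposite order, and the closing slice has at most one
    element. *)
Lemma routing_not_friendly s t a b a' b' x u : s \in routing -> t \in routing ->
  s != t -> s = a ++ (x :: u) ++ b -> t = a' ++ (x :: u) ++ b' ->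
  ~~ [&& enters west a x, exits south (last x u) b,
         enters north a' x & exits east (last x u) b'].
Proof.
move=> sY tY st Es Et; apply/negP => /and4P[h1 h2 h3 h4].
set p := a ++ x :: u; set q := a' ++ x :: u; set v := last x u.
have Es' : s = p ++ b by rewrite Es catA.
have Et' : t = q ++ b' by rewrite Et catA.
have p0 : p != [::] by rewrite /p; case: (a).
have q0 : q != [::] by rewrite /q; case: (a').
have lp : last (0, 0) p = v by rewrite last_cat.
have lq : last (0, 0) q = v by rewrite last_cat.
rewrite Es' in sY; rewrite Et' in tY.
have ne : p <> q.
  move=> E; move/eqP: st; apply; rewrite Es' Et' E; congr cat.
  by apply: (routing_unique q0) => //; rewrite -E.
have pq : precedes p q by exists a, a', x, u.
have Hp : p \in slice1 D true v (S v) \/ p \in south_slice D true v (S v).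
  case: b h2 sY {Es Es'} => [|w b] h2 sY.
    by left; have [_] := routing_strand sY; rewrite cats0 lp.
  have [[E _]|[_ ->]] := routing_prefix p0 lp sY; last by right.
  by move: h2; rewrite /exits /= E eq_sym (negPf (south_neq_east v)).
have Hq : q \in east_slice D true v (S v) \/ q \in slice1 D true v (S v).
  case: b' h4 tY {Et Et'} => [|w b'] h4 tY.
    by right; have [_] := routing_strand tY; rewrite cats0 lq.
  have [[_ ->]|[E _]] := routing_prefix q0 lq tY; first by left.
  by move: h4; rewrite /exits /= E (negPf (south_neq_east v)).
have := strands_sorted true balD hk0 v.
rewrite -{1}(slices_cat D true v (S v)) !pairwise_cat.
move=> /and3P[/allrelP r0 _ /and3P[/allrelP r1 _ _]].
case: Hp Hq => Hp [] Hq.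
- by apply: (precedes_anti pq); apply/asboolP/r0; rewrite // mem_cat Hp.
- have [_ _] := size_slices true balD hk0 v.
  move: Hp Hq; case: (slice1 _ _ _ _) => [|r [|? ?]] //; last by case: (closer D v).
  by rewrite !inE => /eqP Ep /eqP Eq _; case: ne; rewrite Ep.
- by apply: (precedes_anti pq); apply/asboolP/r0; rewrite // mem_cat [p \in slice2 _ _ _ _]Hp orbT.
- by apply: (precedes_anti pq); apply/asboolP/r1.
Qed.

Lemma routing_nonfriendly : nonfriendly_set l routing.
Proof.
split=> [s /routing_segments //|s t [|x u] sY tY st //= _].
apply/negP => /and3P[/infixP[a [b Es]] /infixP[a' [b' Et]]].
have us := segment_uniq (routing_segments sY); have ut := segment_uniq (routing_segments tY).
rewrite (friendly_orderedP us ut Es Et) (friendly_orderedP ut us Et Es).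
rewrite (negPf (routing_not_friendly sY tY st Es Et)).
by rewrite (negPf (routing_not_friendly tY sY _ Et Es)) // eq_sym.
Qed.

End Existence.

Lemma nonfriendly_exists l D : balanced l D ->
  exists2 Y, nonfriendly_set l Y & same_data (data_of Y) D.
Proof.
move=> bD; have [k0 [k1 hk]] := interior_ct_bounds l.
have hk0 v : interior_vertex l v -> k0 < ct v by move/hk/andP => [].
have hk1 v : interior_vertex l v -> ct v < k1 by move/hk/andP => [].
exists (routing l D k0); first exact: (routing_nonfriendly bD hk0).
exact: (routing_data bD hk0 hk1).
Qed.

Lemma nonfriendly_unique l D X Y : balanced l D ->
  nonfriendly_set l X -> same_data (data_of X) D ->
  nonfriendly_set l Y -> same_data (data_of Y) D -> X = Y.
Proof.
move=> bD nX dX nY dY; apply: (coherent_unique bD) dX _ _ _ dY _;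
by [exact: nonfriendly_segments|exact: (nonfriendly_ends (l := l))|exact: (nonfriendly_coherent (l := l))].
Qed.

(** * Descent segments *)

(** For an order ideal and an interior vertex this is the boundary condition: a block that is cut
    contains its SW cell and misses its NE cell. *)
Definition frontier (U : pred cell) (v : vertex) : bool :=
  U (south (west v)) && ~~ U v.

(** The vertices of the rectangle spanned by the SE-corner of [d] and the NW-corner of [c]. *)
Definition in_box (d c v : vertex) : bool :=
  (d.1 < v.1 <= c.1) && (c.2 < v.2 <= d.2).

Lemma in_boxP d c v : ct d < ct v < ct c -> strictly_nw d c ->
  ~~ cell_le v d -> ~~ cell_le v c -> ~~ cell_le d (south (west v)) ->
  ~~ cell_le c (south (west v)) -> in_box d c v.
Proof.
rewrite /in_box /strictly_nw /cell_le /ct /south /west /=.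
by case: d c v => [? ?] [? ?] [? ?] /=; lia.
Qed.

Lemma in_box_last d c v : in_box d c v -> ct v = ct c - 1 -> v = north c.
Proof. by rewrite /in_box /ct; case: v d c => ? ? [? ?] [? ?] /=; vtx. Qed.

Lemma in_box_first d c : strictly_nw d c -> in_box d c (east d).
Proof. by rewrite /in_box /strictly_nw; case: d c => ? ? [? ?] /=; lia. Qed.

Lemma in_box_east d c v : in_box d c v -> ct v < ct c -> ~~ cell_le c (south v) ->
  in_box d c (east v).
Proof. by rewrite /in_box /cell_le /ct; case: v d c => ? ? [? ?] [? ?] /=; vtx. Qed.

Lemma in_box_south d c v : in_box d c v -> ct v < ct c -> ~~ cell_le (south v) c ->
  in_box d c (south v).
Proof. by rewrite /in_box /cell_le /ct; case: v d c => ? ? [? ?] [? ?] /=; vtx. Qed.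

Lemma strictly_nw_ct d c : strictly_nw d c -> ct d < ct (east d) < ct c.
Proof. by rewrite /strictly_nw /ct; case: d c => ? ? [? ?] /=; lia. Qed.

Section Frontier.
Variable l : grid_shape.
Notation K := (cells l).

Definition ideal (U : pred cell) : Prop :=
  (forall x, U x -> x \in K) /\
  (forall x y, U x -> y \in K -> cell_le y x -> U y).

Definition maximal_in (U : pred cell) (c : cell) : Prop :=
  forall x, U x -> cell_le c x -> x = c.

Lemma around_east v : [seq c <- around v | c \in around (east v)] = [:: v; south v].
Proof.
have H1 : v \in around (east v) by rewrite /around !inE eastK eqxx orbT.
have H2 : (west v \in around (east v)) = false.
  by rewrite /around !inE; case: (v) => a b; vtx.
have H3 : south v \in around (east v) by rewrite /around !inE eastK eqxx !orbT.
have H4 : (south (west v) \in around (east v)) = false.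
  by rewrite /around !inE; case: (v) => a b; vtx.
by rewrite {1}/around /= H1 H2 H3 H4.
Qed.

Lemma around_south v :
  [seq c <- around v | c \in around (south v)] = [:: south v; south (west v)].
Proof.
have H1 : (v \in around (south v)) = false.
  by rewrite /around !inE; case: (v) => a b; vtx.
have H2 : (west v \in around (south v)) = false.
  by rewrite /around !inE; case: (v) => a b; vtx.
have H3 : south v \in around (south v) by rewrite /around !inE eqxx.
have H4 : south (west v) \in around (south v) by rewrite /around !inE -[west (south v)]/(south (west v)) eqxx !orbT.
by rewrite {1}/around /= H1 H2 H3 H4.
Qed.

Variable U : pred cell.
Hypothesis idU : ideal U.

Lemma ideal_le x y : U x -> y \in K -> cell_le y x -> U y.
Proof. exact: idU.2. Qed.

Lemma vertex_on_boundaryE v : interior_vertex l v -> vertex_on_boundary U v = frontier U v.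
Proof.
rewrite interiorE => /and4P[K1 K2 K3 K4].
have w1 : U v -> U (west v) by move/ideal_le; apply=> //; vtx.
have w2 : U v -> U (south v) by move/ideal_le; apply=> //; vtx.
have w3 : U (west v) -> U (south (west v)) by move/ideal_le; apply=> //; vtx.
have w4 : U (south v) -> U (south (west v)) by move/ideal_le; apply=> //; vtx.
rewrite /vertex_on_boundary /frontier /=.
case: (U v) w1 w2 => [/(_ isT) E1 /(_ isT) E2|_ _]; first by rewrite E1 E2 (w3 E1).
case: (U (south (west v))) w3 w4 => [_ _|w3 w4].
  by case: (U (west v)); case: (U (south v)).
by case: (U (west v)) w3 => [/(_ isT)//|_]; case: (U (south v)) w4 => [/(_ isT)//|_].
Qed.

Lemma edge_on_boundaryE v w : frontier U v -> frontier U w -> se_step v w ->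
  edge_on_boundary U v w.
Proof.
move=> /andP[v1 v2] /andP[w1 w2] /orP[] /eqP E; subst w; rewrite /edge_on_boundary.
  by rewrite around_south /= (negPf w2) v1.
by rewrite around_east /= (negPf v2); move: w1; rewrite eastK => ->.
Qed.

Lemma on_boundaryE s : segment l s -> on_boundary U s = all (frontier U) s.
Proof.
case/and3P => s0 sI so.
have E : all (vertex_on_boundary U) s = all (frontier U) s.
  by apply: eq_in_all => v /(allP sI); exact: vertex_on_boundaryE.
rewrite /on_boundary E andb_idr // => {E sI}.
case: s s0 so => // x s _ /=; elim: s x => [|y s IH] x //= /andP[st so] /and3P[fx fy fs].
by rewrite edge_on_boundaryE //= IH //= fy.
Qed.

(** On one diagonal the NE cell of the lower vertex lies weakly below the SW cell of the upper one,
    so the latter cannot be inside the ideal while the former is outside. *)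
Lemma frontier_le v w : interior_vertex l v -> frontier U v -> frontier U w ->
  ct v = ct w -> v.1 < w.1 -> False.
Proof.
rewrite interiorE => /and4P[K1 _ _ _] /andP[_ v2] /andP[w1 _] E lt.
move/negP: v2; apply; apply: (ideal_le w1) => //.
by move: E lt; rewrite /cell_le /south /west /ct /=; case: (v) (w) => ? ? [? ?] /=; lia.
Qed.

Lemma frontier_inj v w : interior_vertex l v -> interior_vertex l w ->
  frontier U v -> frontier U w -> ct v = ct w -> v = w.
Proof.
move=> vI wI fv fw E; have [lt|lt|eq] := ltgtP v.1 w.1.
- by case: (frontier_le vI fv fw E lt).
- by case: (frontier_le wI fw fv (esym E) lt).
by move: E eq {vI wI fv fw}; case: v w => ? ? [? ?]; rewrite /ct /=; vtx.
Qed.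

Lemma segment_ct_last x s : path se_step x s -> ct (last x s) = ct x + (size s)%:Z.
Proof.
elim: s x => [|y s IH] x /=; first by rewrite addr0.
by case/andP=> /ct_step E /IH ->; rewrite E -addrA -intS.
Qed.

Lemma frontier_segment_unique s t : segment l s -> segment l t ->
  all (frontier U) s -> all (frontier U) t ->
  initial s = initial t -> terminal s = terminal t -> s = t.
Proof.
case: s t => [|x s] [|y t] // /and3P[_ sI sp] /and3P[_ tI tp] fs ft; rewrite /initial /= => E.
subst y; rewrite /terminal /= => El; congr cons.
elim: s t x El sI sp tI tp fs ft => [|y s IH] [|z t] x //= El.
- by move=> _ _ _ /andP[/ct_step st /segment_ct_last]; rewrite -El st; lia.
- by move=> _ /andP[/ct_step st /segment_ct_last]; rewrite El st; lia.
case/and3P=> _ yI sI /andP[sy sp] /and3P[_ zI tI] /andP[tz tp] /and3P[_ fy fs] /and3P[_ fz ft].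
have E : y = z by apply: frontier_inj => //; rewrite (ct_step sy) (ct_step tz).
by subst z; congr cons; apply: (IH _ y); rewrite //= ?yI ?fy.
Qed.

Hypothesis hl : reflected_skew_shape l.
Variables d c : cell.
Hypotheses (Ud : U d) (Uc : U c) (maxd : maximal_in U d) (maxc : maximal_in U c).
Hypothesis dc : strictly_nw d c.

Lemma frontier_box v : interior_vertex l v -> frontier U v -> ct d < ct v < ct c ->
  in_box d c v.
Proof.
rewrite interiorE => /and4P[K1 _ _ _] /andP[v1 v2] lt.
have E : ct (south (west v)) = ct v by rewrite !ctE subrK.
have /andP[lt1 lt2] := lt; apply: in_boxP => //.
- by apply: contra v2 => H; exact: (ideal_le Ud).
- by apply: contra v2 => H; exact: (ideal_le Uc).
- by apply/negP => /(maxd v1) E'; move: lt1; rewrite -E E' ltxx.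
- by apply/negP => /(maxc v1) E'; move: lt2; rewrite -E E' ltxx.
Qed.

Lemma box_interior v : in_box d c v -> interior_vertex l v.
Proof. by case/andP; apply: rectangle_interior => //; exact: idU.1. Qed.

(** The walk goes East if the SE cell of [v] is in the ideal and South otherwise. Maximality of [d]
    and [c] keeps it in the box, where the last diagonal before [c] holds only the NW-corner of
    [c]. *)
Lemma frontier_path_from v : interior_vertex l v -> frontier U v -> ct d < ct v < ct c ->
  exists s, [/\ segment l (v :: s), all (frontier U) (v :: s) & last v s = north c].
Proof.
have [n] := ubnP (absz (ct c - ct v)); elim: n v => [|n IH] v // lt vI fv hv.
have box := frontier_box vI fv hv; have /andP[hv1 hv2] := hv.
have [E|ne] := eqVneq (ct v) (ct c - 1).
  exists [::]; split; rewrite /= ?fv /segment /= ?vI //.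
  exact: in_box_last box E.
have /andP[f1 f2] := fv.
have Kv w : interior_vertex l w -> [/\ w \in K, south w \in K & south (west w) \in K].
  by rewrite interiorE => /and4P[].
have [K1 K3 K4] := Kv v vI.
have step w : se_step v w -> in_box d c w -> frontier U w ->
    exists s, [/\ segment l (v :: s), all (frontier U) (v :: s) & last v s = north c].
  move=> vw bw fw; have ctw := ct_step vw.
  have [||||s [sg fs ls]] := IH w.
  - by clear -lt hv1 hv2 ctw; rewrite ctw; lia.
  - exact: box_interior.
  - by [].
  - by clear -hv1 hv2 ne ctw; rewrite ctw; lia.
  exists (w :: s); split; rewrite ?ls //=; last by rewrite fv.
  by move: sg; rewrite /segment /= vI vw => /andP[-> ->].
have [uS|uS] := boolP (U (south v)).
  apply: (step (east v)); first by rewrite /se_step eqxx orbT.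
    apply: in_box_east => //.
    by apply/negP => /(maxc uS) E; move: ne; rewrite -E ctE addrK eqxx.
  apply/andP; split; first by rewrite eastK.
  by apply: contra f2 => H; apply: (ideal_le H) => //; exact: le_east.
have bS : in_box d c (south v).
  by apply: in_box_south => //; apply: contra uS => H; exact: (ideal_le Uc).
apply: (step (south v)) => //; first by rewrite /se_step eqxx.
have [_ _ K5] := Kv _ (box_interior bS).
by apply/andP; split=> //; apply: (ideal_le f1) => //; exact: south_le.
Qed.

Lemma frontier_path : exists s, [/\ segment l s, all (frontier U) s,
  initial s = east d & terminal s = north c].
Proof.
have vI := box_interior (in_box_first dc).
have : interior_vertex l (east d) by [].
rewrite interiorE eastK => /and4P[K1 K2 K3 K4].
have fv : frontier U (east d).
  apply/andP; split; first by rewrite eastK; apply: (ideal_le Ud) => //; exact: south_le.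
  apply/negP => H; have /(maxd H) := le_east d.
  by move/(congr1 ct)/eqP; rewrite ctE -subr_eq0 addrC addrA addNr add0r oner_eq0.
have [s [sg fs ls]] := frontier_path_from vI fv (strictly_nw_ct dc).
by exists (east d :: s).
Qed.

End Frontier.

(** * Descent sets of a standard tableau *)

Section Tableau.
Variable l : grid_shape.
Hypothesis hl : reflected_skew_shape l.
Variable T : cell -> nat.
Hypothesis hT : standard_tableau l T.
Notation K := (cells l).
Notation N := (n_cells l).

Lemma tableau_range c : c \in K -> (1 <= T c <= N)%N.
Proof. by move=> Kc; case: hT => -[H _ _] _; apply: H. Qed.

Lemma tableau_inj c d : c \in K -> d \in K -> T c = T d -> c = d.
Proof. by move=> Kc Kd E; case: hT => -[_ H _] _; apply: H => //; apply/mem_set. Qed.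

Lemma cell_ofP k : (1 <= k <= N)%N -> cell_of l T k \in K /\ T (cell_of l T k) = k.
Proof.
move=> hk; case: hT => -[_ _ H] _; have [c Kc Ec] := H k hk.
by rewrite /cell_of; apply: (@xgetPex _ (0, 0) [set c | c \in K /\ T c = k]%classic); exists c.
Qed.

Lemma cell_of_unique c : c \in K -> cell_of l T (T c) = c.
Proof.
move=> Kc; have [K' E] := cell_ofP (tableau_range Kc); exact: tableau_inj.
Qed.

Lemma ideal_below k : ideal l (below l T k).
Proof.
split=> [x /andP[] //|x y /andP[Kx Tx] Ky yx]; rewrite /below Ky /=.
by apply: leq_trans Tx; case: hT => _; apply.
Qed.

Lemma descent_cells i : descent l T i ->
  [/\ cell_of l T i \in K, T (cell_of l T i) = i, cell_of l T i.+1 \in K,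
      T (cell_of l T i.+1) = i.+1 & strictly_nw (cell_of l T i.+1) (cell_of l T i)].
Proof.
case/andP => hi sn; have [|K1 T1] := @cell_ofP i; first by lia.
by have [|K2 T2] := @cell_ofP i.+1; first by lia.
Qed.

(** The two cells carry the largest labels of the ideal and are incomparable, so both are maximal in
    it. *)
Lemma descent_setup i : descent l T i -> let U := below l T i.+1 in
  let d := cell_of l T i.+1 in let c := cell_of l T i in
  [/\ U d, U c, maximal_in U d & maximal_in U c].
Proof.
case/descent_cells => K1 T1 K2 T2 sn /=; split.
- by rewrite /below K2 T2 leqnn.
- by rewrite /below K1 T1 leqnSn.
- move=> x /andP[Kx Tx] le; apply: tableau_inj => //; apply/eqP; rewrite eqn_leq T2 Tx /=.
  by rewrite -{1}T2; case: hT => _; apply.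
move=> x /andP[Kx Tx] le.
have : (T (cell_of l T i) <= T x)%N by case: hT => _; apply.
rewrite T1 leq_eqVlt => /orP[/eqP E|lt]; first by apply: tableau_inj; rewrite // T1.
have E : x = cell_of l T i.+1 by apply: tableau_inj; rewrite // T2; lia.
move: sn le; rewrite E /strictly_nw /cell_le.
by case: (cell_of l T i.+1) (cell_of l T i) => ? ? [? ?] /=; lia.
Qed.

Lemma is_descent_segmentE i s : is_descent_segment l T i s <->
  [/\ segment l s, all (frontier (below l T i.+1)) s,
      initial s = east (cell_of l T i.+1) & terminal s = north (cell_of l T i)].
Proof.
split=> -[sg ob ini ter]; split=> //; first by rewrite -(on_boundaryE (ideal_below _) sg).
by rewrite (on_boundaryE (ideal_below _) sg).
Qed.

Lemma descent_segment_unique i s t :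
  is_descent_segment l T i s -> is_descent_segment l T i t -> s = t.
Proof.
move=> /is_descent_segmentE[s1 s2 s3 s4] /is_descent_segmentE[t1 t2 t3 t4].
by apply: (frontier_segment_unique (ideal_below i.+1)) => //; rewrite ?s3 ?s4.
Qed.

Lemma descent_segment_exists i : descent l T i -> exists s, is_descent_segment l T i s.
Proof.
move=> hd; have [Ud Uc md mc] := descent_setup hd; have [_ _ _ _ sn] := descent_cells hd.
have [s H] := frontier_path (ideal_below i.+1) hl Ud Uc md mc sn.
by exists s; apply/is_descent_segmentE.
Qed.

Lemma descent_segmentP i : descent l T i -> is_descent_segment l T i (descent_segment l T i).
Proof.
move=> /descent_segment_exists[s H].
by apply: (@xgetPex _ [::] [set s | is_descent_segment l T i s]%classic); exists s.
Qed.

Lemma DesP s : reflect (exists2 i, descent l T i & s = descent_segment l T i) (s \in Des l T).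
Proof.
apply: (iffP (imfsetP _ _ _ _)) => /= [[i]|[i hi ->]].
  by rewrite inE /= => /andP[_ hi] ->; exists i.
exists i => //=; rewrite inE /= hi andbT mem_iota.
by case/andP: hi => H _; lia.
Qed.

Lemma Des_segments : segments l (Des l T).
Proof. by move=> s /DesP[i /descent_segmentP[? ? ? ?] ->]. Qed.

Lemma descent_segment_inj i j : descent l T i -> descent l T j ->
  initial (descent_segment l T i) = initial (descent_segment l T j) -> i = j.
Proof.
move=> hi hj; have [_ _ -> _] := descent_segmentP hi; have [_ _ -> _] := descent_segmentP hj.
have [_ _ _ Ei _] := descent_cells hi; have [_ _ _ Ej _] := descent_cells hj.
by move/(congr1 west); rewrite !eastK => E; move: Ej; rewrite -E Ei => -[].
Qed.

Lemma Des_ends : distinct_ends (Des l T).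
Proof.
split=> _ _ /DesP[i hi ->] /DesP[j hj ->] => [|E].
  by move/(descent_segment_inj hi hj) ->.
congr descent_segment; move: E.
have [_ _ _ ->] := descent_segmentP hi; have [_ _ _ ->] := descent_segmentP hj.
have [_ Ei _ _ _] := descent_cells hi; have [_ Ej _ _ _] := descent_cells hj.
by move/(congr1 south); rewrite !northK => E; move: Ej; rewrite -E Ei.
Qed.

(** The label of the NW cell at the entry vertex dates the descent. For a segment that starts at [x]
    this cell has label [i.+1]; for one coming from the West it lies outside the ideal, and for one
    from the North inside. The SE cell at the exit vertex gives the matching bounds below. *)
Lemma descent_enters_west i a x u : descent l T i -> descent_segment l T i = a ++ x :: u ->
  enters west a x -> (i < T (west x))%N.
Proof.
move=> hi E; have /is_descent_segmentE[sg fs ini _] := descent_segmentP hi.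
have [_ _ _ Ti _] := descent_cells hi.
have : interior_vertex l x by apply: (segment_interior sg); rewrite E mem_cat mem_head orbT.
rewrite interiorE => /and4P[_ Kw _ _].
case: (lastP a) E => [|a' z] E.
  move=> _; suff -> : west x = cell_of l T i.+1 by rewrite Ti.
  by move: ini; rewrite E /initial /= => ->; rewrite eastK.
rewrite /enters last_rcons; have -> : (rcons a' z == [::]) = false by case: (a').
move=> /eqP Ez; have : frontier (below l T i.+1) z.
  by apply: (allP fs); rewrite E mem_cat mem_rcons mem_head.
by case/andP => _; rewrite Ez /below Kw /= -ltnNge => /ltnW.
Qed.

Lemma descent_enters_north i a x u : descent l T i -> descent_segment l T i = a ++ x :: u ->
  enters north a x -> (T (west x) <= i.+1)%N.
Proof.
move=> hi E; have /is_descent_segmentE[sg fs ini _] := descent_segmentP hi.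
have [_ _ _ Ti _] := descent_cells hi.
case: (lastP a) E => [|a' z] E.
  move=> _; suff -> : west x = cell_of l T i.+1 by rewrite Ti.
  by move: ini; rewrite E /initial /= => ->; rewrite eastK.
rewrite /enters last_rcons; have -> : (rcons a' z == [::]) = false by case: (a').
move=> /eqP Ez; have : frontier (below l T i.+1) z.
  by apply: (allP fs); rewrite E mem_cat mem_rcons mem_head.
case/andP; rewrite Ez -[south (west (north x))]/(south (north (west x))) northK.
by case/andP.
Qed.

Lemma descent_exit_east i p v b : descent l T i ->
  descent_segment l T i = rcons p v ++ b -> (0 < exit_rank false v b)%N ->
  (T (south v) <= i)%N.
Proof.
move=> hi E; have /is_descent_segmentE[sg fs ini ter] := descent_segmentP hi.
have [_ Tc Kd Td _] := descent_cells hi.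
case: b E => [|w b] E.
  move=> _; suff -> : south v = cell_of l T i by rewrite Tc.
  by move: ter; rewrite E cats0 /terminal last_rcons => ->; rewrite northK.
rewrite /exit_rank; have [Ew _|//] := eqVneq w (east v).
have : frontier (below l T i.+1) w.
  by apply: (allP fs); rewrite E mem_cat mem_head orbT.
case/andP => + _; rewrite Ew eastK => /andP[Ks].
rewrite leq_eqVlt ltnS => /orP[/eqP Es|//].
(* The label [i.+1] is impossible: the segment starts at the SE-corner of that cell, which would lie
   on a later diagonal than [v]. *)
have Esd : south v = cell_of l T i.+1 by apply: tableau_inj; rewrite // Td.
have : ct (initial (descent_segment l T i)) <= ct v.
  by apply: (segment_ct_head sg); rewrite E mem_cat mem_rcons mem_head.
by rewrite ini -Esd !ctE; lia.
Qed.

Lemma descent_exit_south i p v b : descent l T i ->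
  descent_segment l T i = rcons p v ++ b -> (exit_rank false v b < 2)%N ->
  (i <= T (south v))%N.
Proof.
move=> hi E; have /is_descent_segmentE[sg fs ini ter] := descent_segmentP hi.
have [_ Tc Kd Td _] := descent_cells hi.
have : interior_vertex l v by apply: (segment_interior sg); rewrite E mem_cat mem_rcons mem_head.
rewrite interiorE => /and4P[_ _ Ks _].
case: b E => [|w b] E.
  move=> _; suff -> : south v = cell_of l T i by rewrite Tc.
  by move: ter; rewrite E cats0 /terminal last_rcons => ->; rewrite northK.
rewrite /exit_rank; have [//|ne _] := eqVneq w (east v).
have vw : se_step v w by apply: (segment_step sg); rewrite E cat_rcons.
have Ew : w = south v by move: vw; rewrite /se_step (negPf ne) orbF => /eqP.
have : frontier (below l T i.+1) w.
  by apply: (allP fs); rewrite E mem_cat mem_head orbT.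
by case/andP => _; rewrite Ew /below Ks /= -ltnNge; lia.
Qed.

(* Reading the labels of the cells next to a common subsegment shows that
   segments through a vertex are ordered by the time of their descents. *)
Lemma Des_coherent : coherent false (Des l T).
Proof.
move=> v p b p' b' /DesP[i hi Ei] /DesP[j hj Ej] [a [a' [x [u [E E' ea ea' ne]]]]].
rewrite leqNgt; apply/negP => lt.
have Ei2 : descent_segment l T i = a ++ x :: (u ++ b) by rewrite -Ei E -catA.
have Ej2 : descent_segment l T j = a' ++ x :: (u ++ b') by rewrite -Ej E' -catA.
have h1 := descent_enters_west hi Ei2 ea.
have h2 := descent_enters_north hj Ej2 ea'.
have h3 : (T (south v) <= i)%N.
  by apply: (descent_exit_east hi (esym Ei)); apply: leq_ltn_trans lt.
have h4 : (j <= T (south v))%N.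
  apply: (descent_exit_south hj (esym Ej)); apply: leq_trans lt _.
  by rewrite /exit_rank; case: (b) => // ? ?; case: ifP.
(* The entry labels give [i <= j], the exit labels [j <= i]. *)
have ij : i = j by apply/eqP; rewrite eqn_leq; lia.
have us : uniq (p ++ v :: b).
  by rewrite -cat_rcons Ei; apply: segment_uniq (Des_segments _); apply/DesP; exists i.
have E3 : p ++ v :: b = p' ++ v :: b' by rewrite -!cat_rcons Ei Ej ij.
by apply: ne; have [-> _] := uniq_split us E3.
Qed.

End Tableau.

Lemma Des_unique l T T' D : reflected_skew_shape l ->
  standard_tableau l T -> standard_tableau l T' -> balanced l D ->
  same_data (data_of (Des l T)) D -> same_data (data_of (Des l T')) D -> Des l T = Des l T'.
Proof.
move=> hl hT hT' bD d d'; apply: (coherent_unique bD) d _ _ _ d' _;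
by [exact: Des_segments|exact: Des_ends|exact: Des_coherent].
Qed.

(** * Building a tableau from balanced data *)

Definition remove_segment (D : twist_data) (s : seq vertex) : twist_data := {|
  weight := fun v w => (weight D v w - infix [:: v; w] s)%N;
  starter := fun v => starter D v && (v != initial s);
  closer := fun v => closer D v && (v != terminal s) |}.

Lemma sorted_infix (T : eqType) (r : rel T) s x y : sorted r s -> infix [:: x; y] s -> r x y.
Proof.
move=> so /infixP[a [b E]]; move: so; rewrite E.
by case: a {E} => [|z a] /=; [case/andP|rewrite cat_path /= => /and3P[_ _ /andP[]]].
Qed.

Lemma remove_segment_flow (a b c d i j h k : nat) (st cl ini ter n : bool) :
  (a%:Z + b%:Z) - (c%:Z + d%:Z) = cl%:Z - st%:Z ->
  (i <= a)%N -> (j <= b)%N -> (h <= c)%N -> (k <= d)%N -> (ini -> st) -> (ter -> cl) ->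
  (i + j + ini)%N = n -> (h + k + ter)%N = n ->
  (a - i + (b - j))%N%:Z - (c - h + (d - k))%N%:Z = (cl && ~~ ter)%:Z - (st && ~~ ini)%:Z.
Proof. by case: st; case: cl; case: ini; case: ter; case: n => /=; lia. Qed.

Lemma strictly_nwP d c : ~~ cell_le d c -> ~~ cell_le c d -> ct d < ct c -> strictly_nw d c.
Proof. by rewrite /cell_le /strictly_nw /ct; case: d c => ? ? [? ?] /=; lia. Qed.

Lemma strictly_nw_gap d c : strictly_nw d c -> ct d + 2 <= ct c.
Proof. by rewrite /strictly_nw /ct; case: d c => ? ? [? ?] /=; lia. Qed.

Lemma cell_le_column z z' : cell_le z' z -> ~~ cell_le z' (west z) -> ct z <= ct z'.
Proof. by rewrite /cell_le /west /ct; case: z z' => ? ? [? ?] /=; lia. Qed.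

Section Process.
Variable l : grid_shape.
Hypothesis hl : reflected_skew_shape l.
Notation K := (cells l).
Notation N := (n_cells l).

Lemma balanced_remove D s : balanced l D -> segment l s ->
  sorted (fun v w => weight D v w != 0%N) s -> starter D (initial s) -> closer D (terminal s) ->
  balanced l (remove_segment D s).
Proof.
move=> [B1 B2 B3] sg so st cl; split=> [v w|v|v vI] /=.
- by move=> H; apply: B1; apply: contra_neq H => ->; rewrite sub0n.
- by move=> H; apply: B2; case/orP: H => /andP[-> _]; rewrite ?orbT.
have pos x y : (infix [:: x; y] s <= weight D x y)%N.
  by case E: (infix _ _) => //=; rewrite lt0n; exact: (sorted_infix so E).
rewrite [v == initial s]eq_sym [v == terminal s]eq_sym.
apply: (remove_segment_flow _ (pos _ _) (pos _ _) (pos _ _) (pos _ _) _ _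
  (segment_inflow v sg) (segment_outflow v sg)).
- by have := B3 v vI; rewrite !PoszD.
- by move/eqP <-.
- by move/eqP <-.
Qed.

(** Besides forming an ideal, the cells of [tau] are listed in an order compatible with the poset,
    so that positions can serve as labels. *)
Definition closed_under (tau : seq cell) : Prop :=
  forall x y, x \in tau -> y \in K -> cell_le y x ->
    (y \in tau) && (index y tau <= index x tau)%N.

Definition addable (tau : seq cell) (d : cell) : Prop :=
  [/\ d \in K, d \notin tau & forall x, x \in K -> cell_le x d -> x != d -> x \in tau].

(* A cell that can be added without using up any of the remaining data. *)
Definition ready (tau : seq cell) (D : twist_data) (d : cell) : Prop :=
  [/\ addable tau d, weight D d (east d) = 0%N, weight D (north d) d = 0%N
    & ~~ starter D (east d)].

(** [tau] lists the placed cells, [D] is the data still to be realized. An edge of positive weight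
    has an unplaced cell on its North or East side, and a starter is not the SE-corner of a placed
    cell. A closer that is the NW-corner of a placed cell belongs to the last one, since its descent
    must follow at once. The bound in [st_ready] ensures that adding a ready cell is no descent, as
    a descent drops two diagonals. *)
Record state (tau : seq cell) (D : twist_data) : Prop := State {
  st_nil : tau != [::];
  st_uniq : uniq tau;
  st_sub : {subset tau <= K};
  st_closed : closed_under tau;
  st_bal : balanced l D;
  st_east : forall v, weight D v (east v) != 0%N -> v \notin tau;
  st_south : forall v, weight D v (south v) != 0%N -> south v \notin tau;
  st_starter : forall v, starter D v -> west v \notin tau;
  st_closer : forall v, closer D v -> south v \in tau -> south v = last (0, 0) tau;
  st_ready : forall d, ready tau D d -> ct (last (0, 0) tau) - 1 <= ct d
}.

Section Step.
Variables (tau : seq cell) (D : twist_data).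
Hypothesis S : state tau D.
Let c := last (0, 0) tau.

Lemma last_in : c \in tau.
Proof. by rewrite /c; case: (tau) (st_nil S) => // x s _; rewrite /= mem_last. Qed.

Lemma closed_mem x y : x \in tau -> y \in K -> cell_le y x -> y \in tau.
Proof. by move=> H1 H2 H3; have /andP[] := st_closed S H1 H2 H3. Qed.

Lemma last_maximal x : x \in tau -> cell_le c x -> x = c.
Proof.
move=> xt cx; have /andP[_] := st_closed S xt (st_sub S last_in) cx.
have Ei : index c tau = (size tau).-1 by rewrite /c; case: (tau) (st_nil S) (st_uniq S) => // x' s _ us; exact: index_last.
move=> le; have E : index x tau = index c tau.
  by apply/eqP; rewrite eqn_leq le andbT Ei -ltnS prednK ?index_mem // lt0n size_eq0 (st_nil S).
by rewrite -(nth_index (0, 0) xt) E nth_index // last_in.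
Qed.

Lemma addable_local d : d \in K -> d \notin tau -> (west d \in K -> west d \in tau) ->
  (south d \in K -> south d \in tau) -> addable tau d.
Proof.
move=> Kd dt hw hs; split=> // x Kx xd ne.
by have [[Kw le]|[Ks le]] := cell_pred hl Kx Kd xd ne; [have := hw Kw|have := hs Ks];
  move/closed_mem; apply.
Qed.

Lemma addable_below z : z \in K -> z \notin tau -> exists2 d, addable tau d & cell_le d z.
Proof.
move=> Kz zt.
have [|d [Kd /andP[dt dz] dmin]] :=
  @seq_argmin _ (fun x : cell => x.1 + x.2) (fun x => (x \notin tau) && cell_le x z) K z Kz.
  by rewrite zt cell_le_refl.
exists d => //; split=> // x Kx xd; apply: contraR => xt.
have := dmin x Kx; rewrite xt (cell_le_trans xd dz) => /(_ isT); move: xd.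
rewrite /cell_le; clear; case: d x => ? ? [? ?] /=; rewrite xpair_eqE; lia.
Qed.

(* Balance at the vertex y propagates westwards along the top of the placed cells,
   up to a corner where a cell is ready. *)
Lemma blocked_starter B : (forall d, ready tau D d -> B < ct d) ->
  (forall v, closer D v -> south v \in tau -> B < ct v) ->
  forall y, y \in K -> y \notin tau -> south y \in tau -> ct y <= B ->
  weight D y (east y) = 0%N ->
  [/\ addable tau y, starter D (east y) & weight D (north y) y = 0%N].
Proof.
move=> Hr Hc y; have [k0 [k1 hk]] := cells_ct_bounds l.
have [n] := ubnP (absz (ct y - k0)); elim: n y => [|n IH] y // lt Ky yt st cy we.
have ws : weight D y (south y) = 0%N by apply/eqP/negPn/negP => /(st_south S); rewrite st.
have cl : closer D y = false.
  by apply/negP => /Hc/(_ st); rewrite ltNge cy.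
have := balanced_flow y (st_bal S); rewrite we ws cl => /eqP.
rewrite !addn_eq0 => /andP[/andP[/eqP ww /eqP wn] ns].
have hw : west y \in K -> west y \in tau.
  move=> Kw; apply: contraT => wt.
  have yI : interior_vertex l y by apply: interior_nw_se => //; exact: (st_sub S).
  have H1 : (`|ct (west y) - k0| < n)%N.
    have := hk _ Kw; have := hk _ Ky; rewrite ctE; clear -lt; lia.
  have H2 : south (west y) \in tau.
    apply: (closed_mem st); first by move: yI; rewrite interiorE => /and4P[].
    by rewrite south_west; exact: west_le.
  have H3 : ct (west y) <= B by rewrite ctE; clear -cy; lia.
  have [_] := IH (west y) H1 Kw wt H2 H3 ltac:(by rewrite westK).
  by rewrite westK; case: (starter D y) ns.
have ad : addable tau y by apply: addable_local.
split=> //; apply: contraT => nst.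
by have := Hr y (And4 ad we wn nst); rewrite ltNge cy.
Qed.

Lemma no_east v : v \in tau -> weight D v (east v) = 0%N.
Proof. by move=> vt; apply/eqP/negPn/negP => /(st_east S); rewrite vt. Qed.
Lemma no_starter v : west v \in tau -> starter D v = false.
Proof. by move=> vt; apply/negP => /(st_starter S); rewrite vt. Qed.

(** Positive weight is traced backwards. If the NW cell of [v] is placed, balance forces a positive
    edge from the North. Otherwise weight from the West is followed; if there is none, the NW cell
    is addable and [v] is a starter, where the segment begins. *)
Lemma positive_path v : interior_vertex l v -> frontier (mem tau) v -> ct v <= ct c - 1 ->
  (0 < weight D v (east v) + weight D v (south v) + closer D v)%N ->
  exists d s, [/\ [/\ addable tau d, weight D d (east d) = 0%N & weight D (north d) d = 0%N],
    segment l s /\ all (frontier (mem tau)) s,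
    sorted (fun v w => weight D v w != 0%N) s,
    starter D (initial s) & initial s = east d /\ terminal s = v].
Proof.
have [k0 [k1 hk]] := interior_ct_bounds l.
have [n] := ubnP (absz (ct v - k0)); elim: n v => [|n IH] v // lt vI fv cv.
rewrite -(balanced_flow v (st_bal S)) => pos.
have [vK wK _ sK] := and4P (eq_ind _ is_true vI _ (interiorE l v)).
have /andP[/= f1 f2] := fv.
have ext u : se_step u v -> weight D u v != 0%N -> frontier (mem tau) u ->
    (0 < weight D u (east u) + weight D u (south u) + closer D u)%N ->
    exists d s, [/\ [/\ addable tau d, weight D d (east d) = 0%N & weight D (north d) d = 0%N],
      segment l s /\ all (frontier (mem tau)) s,
      sorted (fun v w => weight D v w != 0%N) s,
      starter D (initial s) & initial s = east d /\ terminal s = v].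
  move=> uv wuv fu pu; have [uI _] := weight_interior (st_bal S) wuv.
  have E := ct_step uv.
  have [||d [s [had [sg fs] so st [ini ter]]]] := IH u _ uI fu _ pu.
  - have := hk _ uI; have := hk _ vI; clear -lt E; lia.
  - by clear -cv E; lia.
  exists d, (rcons s v); case: s sg fs so st ini ter => [|x s] // sg fs so st ini ter.
  have lu : last x s = u := ter.
  split=> //; last by rewrite /terminal last_rcons.
  - split; last by rewrite all_rcons fv.
    move: sg; rewrite /segment all_rcons vI /= => /andP[-> ]; rewrite rcons_path => ->.
    by rewrite lu uv.
  - by rewrite /= rcons_path lu wuv andbT.
have [wt|wt] := boolP (west v \in tau).
  rewrite (no_starter wt) (_ : weight D (west v) v = 0%N) in pos; last first.
    by rewrite -{2}(westK v) no_east.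
  rewrite add0n addn0 in pos.
  apply: (ext (north v)); rewrite ?se_stepP ?eqxx // -?lt0n ?northK //.
    apply/andP; split=> /=; first by rewrite -[south _]/(west (south (north v))) northK.
    by apply: contra f2 => H; apply: (closed_mem H) => //; exact: le_north.
  by rewrite addnAC; apply: leq_trans (leq_addl _ _).
have [ww|ww] := eqVneq (weight D (west v) v) 0%N; last first.
  apply: (ext (west v)); rewrite ?se_stepP ?eqxx ?orbT // ?westK.
    have [uI _] := weight_interior (st_bal S) ww.
    apply/andP; split=> //=; apply: (closed_mem f1).
      by move: uI; rewrite interiorE => /and4P[].
    by rewrite south_west; exact: west_le.
  by rewrite -addnA; apply: leq_trans (leq_addr _ _); rewrite lt0n.
(* Both thresholds hold for [ct c - 2]: ready cells have diagonal at least [ct c - 1], and a closer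
   over a placed cell is [north c], on the diagonal [ct c - 1]. *)
have [||||ad st wn] := @blocked_starter (ct c - 2) _ _ (west v) wK wt f1.
- by move=> d /(st_ready S); rewrite -/c; clear; lia.
- by move=> u cu /(st_closer S cu) E; have := ctE.2 u; rewrite E -/c; clear; lia.
- by rewrite ctE; clear -cv; lia.
- by rewrite westK.
exists (west v), [:: v]; rewrite westK in st; split=> //; rewrite /= ?fv //.
- by split=> //; rewrite westK.
- by split=> //; rewrite /segment /= vI.
- by rewrite /initial /= westK.
Qed.

(** If nothing is ready, [blocked_starter] applies with every bound. Let [y] be the unplaced cell
    over a placed one with the largest [ct]. Then [east y] is an interior vertex, and either the
    cell [east y] or an addable cell below [south (east y)] is of the same kind with larger [ct]. *)
Lemma ready_exists z : ~~ closer D (north c) -> z \in K -> z \notin tau ->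
  exists d, ready tau D d.
Proof.
move=> ncl Kz zt; apply: contrapT => nor.
have Hr B d : ready tau D d -> B < ct d by move=> rd; case: nor; exists d.
have Hc (B : int) v : closer D v -> south v \in tau -> B < ct v.
  move=> cv /(st_closer S cv) E; move: ncl.
  by rewrite /c -E southK cv.
have bottom y : addable tau y -> south y \in K.
  move=> ad; apply: contraT => sK; case: nor; exists y; split=> //.
  - apply/eqP/negPn/negP => /(weight_interior (st_bal S))[].
    by rewrite interiorE (negPf sK) !andbF.
  - apply/eqP/negPn/negP => /(weight_interior (st_bal S))[_].
    by rewrite interiorE (negPf sK) !andbF.
  apply/negP => H; case: (st_bal S) => _ /(_ (east y)); rewrite H => /(_ isT).
  by rewrite interiorE eastK (negPf sK) !andbF.
have bottom_tau y : addable tau y -> south y \in tau.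
  move=> ad; have sK := bottom y ad; case: ad => _ _; apply=> //; first exact: south_le.
  by apply/eqP => /(congr1 ct); rewrite ctE; clear; lia.
have [y0 ad0 _] := addable_below Kz zt; have [Ky0 yt0 _] := ad0.
have [|y [Ky /andP[yt st] ymax]] := @seq_argmin _ (fun x => - ct x)
    (fun x => (x \notin tau) && (south x \in tau)) K y0 Ky0.
  by rewrite yt0 bottom_tau.
have eI : interior_vertex l (east y).
  have [we|we] := eqVneq (weight D y (east y)) 0%N; last first.
    by have [] := weight_interior (st_bal S) we.
  have [_ H _] := blocked_starter (Hr (ct y)) (Hc (ct y)) Ky yt st (lexx _) we.
  by case: (st_bal S) => _ B2 _; apply: B2; rewrite H.
move: eI; rewrite interiorE eastK => /and4P[eK _ zK _].
have [zt'|zt'] := boolP (south (east y) \in tau).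
  have := ymax _ eK; rewrite zt' andbT ctE.
  case: (boolP (east y \in tau)) => [H|_ /(_ isT)]; last by clear; lia.
  by move: yt; rewrite (closed_mem H Ky (le_east y)).
have [d ad dz] := addable_below zK zt'; have [Kd dt _] := ad.
have := ymax _ Kd; rewrite dt bottom_tau // => /(_ isT).
have : ct (south (east y)) <= ct d.
  apply: cell_le_column => //; apply: contra dt => H; apply: closed_mem H => //.
  by rewrite -[west _]/(south (west (east y))) eastK.
by rewrite !ctE; clear; lia.
Qed.

Lemma closed_rcons d : addable tau d -> closed_under (rcons tau d).
Proof.
case=> Kd dt ad x y + Ky yx; rewrite !mem_rcons !in_cons -!cats1 !index_cat.
have [E _|xd /= xt] := eqVneq x d; last first.
  by have /andP[yt yi] := st_closed S xt Ky yx; rewrite yt xt orbT.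
subst x; rewrite (negPf dt) /= eqxx addn0; have [->|yd] := eqVneq y d.
  by rewrite (negPf dt) addn0 leqnn.
by rewrite (ad _ Ky yx yd) /= index_size.
Qed.

(** Direct predecessors of [d'] are one diagonal away from it, so [d] is not among them. *)
Lemma addable_rcons d d' : ct d' <= ct d - 2 ->
  addable (rcons tau d) d' -> addable tau d'.
Proof.
move=> lt [Kd' dt' ad]; move: dt'; rewrite mem_rcons inE => /norP[_ dt'].
have back x : x \in K -> cell_le x d' -> x != d' -> ct x != ct d -> x \in tau.
  move=> Kx xd ne nc; have := ad x Kx xd ne; rewrite mem_rcons inE => /orP[/eqP E|//].
  by rewrite E eqxx in nc.
apply: addable_local => // [Kw|Ks]; apply: back => //.
- exact: west_le.
- by apply/eqP => /(congr1 ct); rewrite ctE; clear; lia.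
- by rewrite ctE; clear -lt; lia.
- exact: south_le.
- by apply/eqP => /(congr1 ct); rewrite ctE; clear; lia.
- by rewrite ctE; clear -lt; lia.
Qed.

(** Serves both kinds of step: [D'] is [D] itself or [D] with a segment removed. *)
Lemma state_rcons d D' : addable tau d -> balanced l D' ->
  (forall v w, weight D' v w != 0%N -> weight D v w != 0%N) ->
  (forall v, starter D' v -> starter D v) -> (forall v, closer D' v -> closer D v) ->
  weight D d (east d) = 0%N -> weight D (north d) d = 0%N ->
  ~~ starter D' (east d) -> ~~ closer D' (north c) ->
  (forall d', ready (rcons tau d) D' d' -> ct d - 1 <= ct d') ->
  state (rcons tau d) D'.
Proof.
move=> ad bD hw hs hc we wn ns nc hr; have [Kd dt _] := ad; split=> //.
- by case: (tau).
- by rewrite rcons_uniq dt (st_uniq S).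
- by move=> x; rewrite mem_rcons inE => /orP[/eqP ->|/(st_sub S)].
- exact: closed_rcons.
- move=> v /hw H; rewrite mem_rcons inE negb_or (st_east S H) andbT.
  by apply: contraNneq H => ->; rewrite we.
- move=> v /hw H; rewrite mem_rcons inE negb_or (st_south S H) andbT.
  by apply: contraNneq H => E; rewrite E -[v]southK E wn.
- move=> v H; rewrite mem_rcons inE negb_or (st_starter S (hs _ H)) andbT.
  by apply: contraNneq ns => <-; rewrite westK.
- move=> v H; rewrite mem_rcons inE last_rcons => /orP[/eqP //|/(st_closer S (hc _ H)) E].
  by move: nc; rewrite /c -E southK H.
- by move=> d'; rewrite last_rcons; exact: hr.
Qed.

(** The leftmost ready cell is added. A cell that is ready afterwards and at least two diagonals
    further left was ready before, against minimality. *)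
Lemma step_right z : ~~ closer D (north c) -> z \in K -> z \notin tau ->
  exists d, [/\ addable tau d, state (rcons tau d) D & ~~ strictly_nw d c].
Proof.
move=> ncl Kz zt; have [d0 rd0] := ready_exists ncl Kz zt.
have [Kd0 _ _] := let: And4 ad _ _ _ := rd0 in ad.
have [|d [Kd /asboolP rd dmin]] := @seq_argmin _ ct (fun d => `[< ready tau D d >]) K d0 Kd0.
  exact/asboolP.
have [ad we wn ns] := rd; exists d; split=> //.
  apply: state_rcons => //; first exact: st_bal S.
  move=> d' [ad' we' wn' ns']; rewrite leNgt; apply/negP => lt.
  have ad2 : addable tau d' by apply: (addable_rcons _ ad'); clear -lt; lia.
  have [Kd' _ _] := ad'.
  by have := dmin d' Kd' (introT (asboolP _) (And4 ad2 we' wn' ns')); clear -lt; lia.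
apply/negP => /strictly_nw_gap; have := st_ready S rd; rewrite -/c; clear; lia.
Qed.

(** [positive_path] from the NW-corner of [c] yields [d] and the segment. If [d] were below [c] it
    would be placed; if [c] were below [d], maximality of [c] would make it a direct predecessor of
    [d], one diagonal away instead of at least two. *)
Lemma step_left : closer D (north c) ->
  exists d s, [/\ addable tau d /\ state (rcons tau d) (remove_segment D s),
    segment l s /\ all (frontier (mem (rcons tau d))) s,
    sorted (fun v w => weight D v w != 0%N) s,
    starter D (initial s) /\ initial s = east d
    & terminal s = north c /\ strictly_nw d c].
Proof.
move=> cl; have cK := st_sub S last_in.
have nI : interior_vertex l (north c).
  by case: (st_bal S) => _ B2 _; apply: B2; rewrite cl orbT.
have := nI; rewrite interiorE -[south (west _)]/(west (south (north c))) northK => /and4P[nK _ _ wK].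
have nt : north c \notin tau.
  apply/negP => /last_maximal/(_ (le_north c))/(congr1 ct); rewrite ctE; clear; lia.
have fn : frontier (mem tau) (north c).
  apply/andP; split=> //=; rewrite -[south _]/(west (south (north c))) northK.
  by apply: (closed_mem last_in) => //; exact: west_le.
have [||d [s [[ad we wn] [sg fs] so st [ini ter]]]] := positive_path nI fn.
- by rewrite ctE.
- by rewrite cl addn1.
have [Kd dt adm] := ad.
have cd : ct d <= ct c - 2.
  have := segment_ct_head sg (terminal_mem sg); rewrite ini ter !ctE; clear; lia.
have ds v : v \in s -> ct d < ct v.
  by move=> /(segment_ct_head sg); rewrite ini ctE; clear; lia.
have nw : strictly_nw d c.
  apply: strictly_nwP; last by clear -cd; lia.
    by apply: contra dt => H; apply: (closed_mem last_in).
  apply/negP => H; have ne : c != d by apply: contraTneq last_in => ->.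
  have gap : forall x, x \in K -> cell_le c x -> cell_le x d -> x != d -> x = c.
    by move=> x Kx cx xd xn; apply: last_maximal => //; exact: adm.
  have [[Kw le]|[Ks le]] := cell_pred hl cK Kd H ne.
  - have := gap _ Kw le (west_le d); case: eqP => [/(congr1 ct)|_ /(_ isT)/(congr1 ct)];
      rewrite ctE; clear -cd; lia.
  - have := gap _ Ks le (south_le d); case: eqP => [/(congr1 ct)|_ /(_ isT)/(congr1 ct)];
      rewrite ctE; clear -cd; lia.
exists d, s; split=> //; split=> //.
  apply: state_rcons => //=.
  - by apply: balanced_remove => //; [exact: st_bal S|rewrite ter].
  - by move=> v w; apply: contra_neq => ->; rewrite sub0n.
  - by move=> v /andP[].
  - by move=> v /andP[].
  - by rewrite ini eqxx andbF.
  - by rewrite ter eqxx andbF.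
  (* The removed segment begins one diagonal after [d], so the data around [d'] are unchanged; [d']
     was ready before, which [st_ready] excludes this far left. *)
  move=> d' [ad' /= we' wn' ns']; rewrite leNgt; apply/negP => lt.
  have lt' : ct d' <= ct d - 2 by clear -lt; lia.
  have d's : d' \notin s by apply/negP => /ds; clear -lt; lia.
  rewrite (infix_notin _ d's) subn0 in we'; rewrite (infix_notin _ d's) subn0 in wn'.
  have ne : east d' != east d.
    by apply/eqP => /(congr1 ct); rewrite !ctE; clear -lt; lia.
  rewrite ini ne andbT in ns'.
  have ad2 := addable_rcons lt' ad'.
  have := st_ready S (And4 ad2 we' wn' ns'); rewrite -/c; clear -lt cd; lia.
apply/allP => v vs; have /andP[/= f1 f2] := allP fs v vs.
apply/andP; split=> /=; rewrite mem_rcons inE ?f1 ?orbT // negb_or f2 andbT.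
by apply/eqP => E; have := ds v vs; rewrite E ltxx.
Qed.

End Step.
End Process.

(** * From placement sequences to tableaux with prescribed data *)

Section Realization.
Variable l : grid_shape.
Hypothesis hl : reflected_skew_shape l.
Notation K := (cells l).
Notation N := (n_cells l).

(** The data of the descents [i] with [k <= i < N] of the finished tableau, to be compared with what
    remains once [k] cells are placed. *)
Definition late_data (T : cell -> nat) (k : nat) (D : twist_data) : Prop :=
  let des P := fun i => descent l T i && P (descent_segment l T i) in
  [/\ forall v w, weight D v w = count (des (infix [:: v; w])) (iota k (N - k)),
      forall v, starter D v = has (des (fun s => initial s == v)) (iota k (N - k))
    & forall v, closer D v = has (des (fun s => terminal s == v)) (iota k (N - k))].

Definition extends_filling (T : cell -> nat) (tau : seq cell) : Prop :=
  forall i, (i < size tau)%N -> T (nth (0, 0) tau i) = i.+1.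

Lemma late_data_zero T k D : (N <= k)%N -> (forall v w, weight D v w = 0%N) ->
  (forall v, starter D v = false) -> (forall v, closer D v = false) -> late_data T k D.
Proof. by move=> le w s c; rewrite /late_data (_ : (N - k = 0)%N); [split|lia]. Qed.

Lemma state_size tau D : state l tau D -> (size tau <= N)%N.
Proof. by move=> S; apply: uniq_leq_size (st_uniq S) (st_sub S). Qed.

(** With every cell placed, the invariant excludes weight and starters. A closer [v] would make
    [south v] the last cell, although the cell [v] above it is placed too. *)
Lemma full_standard tau D : state l tau D -> size tau = N ->
  standard_tableau l (fun x => (index x tau).+1) /\
  late_data (fun x => (index x tau).+1) N D.
Proof.
move=> S sz.
have eK : tau =i K.
  by apply: (uniq_min_size (st_uniq S) (st_sub S) _).2; rewrite sz.
have bal := st_bal S.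
split; first split.
- split.
  + by move=> x /= xK; rewrite -sz index_mem eK.
  + move=> x y /set_mem /= xK /set_mem /= yK [] E.
    by rewrite -(nth_index (0, 0) (_ : x \in tau)) ?E ?nth_index ?eK.
  + move=> k /= hk; exists (nth (0, 0) tau k.-1).
      by rewrite /= -eK mem_nth // sz; lia.
    by rewrite index_uniq ?(st_uniq S) ?sz; lia.
- move=> c d Kc Kd cd; rewrite ltnS.
  have dt : d \in tau by rewrite eK.
  by have /andP[] := st_closed S dt Kc cd.
apply: late_data_zero => // [v w|v|v].
- apply/eqP/negPn/negP => H; have [vI wI] := weight_interior bal H.
  case: bal => /(_ v w H)/and3P[_ _ /orP[]/eqP E] _ _; subst w.
    by have := st_south S H; rewrite eK (interior_ne wI).
  by have := st_east S H; rewrite eK (interior_ne vI).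
- apply/negP => H; have := st_starter S H; rewrite eK.
  by have := starter_interior bal H; rewrite interiorE => /and4P[_ -> _ _].
apply/negP => H; have vI := closer_interior bal H.
have /st_closer : closer D v by []; move/(_ _ _ S).
have sK : south v \in tau by rewrite eK; move: vI; rewrite interiorE => /and4P[].
move/(_ sK) => E; have vt : v \in tau by rewrite eK (interior_ne vI).
have := last_maximal S vt; rewrite -E => /(_ (south_le v))/(congr1 ct).
by rewrite ctE; clear; lia.
Qed.

Lemma cell_of_filling T tau i : standard_tableau l T -> {subset tau <= K} ->
  extends_filling T tau -> (i < size tau)%N -> cell_of l T i.+1 = nth (0, 0) tau i.
Proof.
move=> hT sK ft it; rewrite -(ft i it); apply: (cell_of_unique hT).
exact/sK/mem_nth.
Qed.

Lemma extends_rcons T tau d : extends_filling T (rcons tau d) -> extends_filling T tau.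
Proof.
by move=> H i it; have := H i; rewrite size_rcons nth_rcons it; apply; apply: leqW.
Qed.

Lemma late_step T k D : (k < N)%N -> ~~ descent l T k -> late_data T k.+1 D -> late_data T k D.
Proof.
move=> kN nd [H1 H2 H3]; have E : (N - k = (N - k.+1).+1)%N by lia.
by split=> *; rewrite E /= (negPf nd) /= ?H1 ?H2 ?H3.
Qed.

Lemma late_step_descent T k D s : (k < N)%N -> descent l T k -> descent_segment l T k = s ->
  sorted (fun v w => weight D v w != 0%N) s -> starter D (initial s) -> closer D (terminal s) ->
  late_data T k.+1 (remove_segment D s) -> late_data T k D.
Proof.
move=> kN hd Es so st cl [H1 H2 H3]; have E : (N - k = (N - k.+1).+1)%N by lia.
split=> [v w|v|v]; rewrite E /= hd Es /= -?H1 -?H2 -?H3 /=.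
- case Ei : (infix _ _); last by rewrite subn0.
  by have := sorted_infix so Ei; rewrite /=; lia.
- by have [<-|ne] := eqVneq (initial s) v; [rewrite st|rewrite andbT].
- by have [<-|ne] := eqVneq (terminal s) v; [rewrite cl|rewrite andbT].
Qed.

Lemma below_filling T tau : standard_tableau l T -> {subset tau <= K} -> uniq tau ->
  extends_filling T tau -> below l T (size tau) =1 mem tau.
Proof.
move=> hT sK ut ft x /=; apply/andP/idP => [[Kx Tx]|xt].
  have := tableau_range hT Kx => /andP[T1 _].
  rewrite -(cell_of_unique hT Kx) -(prednK T1) (cell_of_filling hT sK ft) ?mem_nth //;
  by rewrite prednK.
split; first exact: sK.
by rewrite -{1}(nth_index (0, 0) xt) ft ?index_mem.
Qed.

(** The tableau is known only when all cells are placed; on the way back each removed segment is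
    restored. It is the segment of the descent at [size tau], the label of the last cell of [tau],
    because frontier segments with given ends are unique. *)
Lemma realize_from tau D : state l tau D -> exists T,
  [/\ standard_tableau l T, extends_filling T tau & late_data T (size tau) D].
Proof.
have [n] := ubnP (N - size tau); elim: n tau D => [|n IH] tau D // lt S.
have := state_size S; rewrite leq_eqVlt => /orP[/eqP sz|ltN].
  have [hT hD] := full_standard S sz.
  exists (fun x => (index x tau).+1); split=> //; last by rewrite sz.
  by move=> i it; rewrite index_uniq // (st_uniq S).
have [z Kz zt] : exists2 z, z \in K & z \notin tau.
  apply: contrapT => H; move: ltN; rewrite ltnNge; move/negP; apply.
  apply: uniq_leq_size; first exact: fset_uniq.
  by move=> x xK; apply: contrapT => /negP xt; apply: H; exists x.
have [k Ek] : exists k, size tau = k.+1.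
  by case: (tau) (st_nil S) => // x s _; exists (size s).
have lastE T : standard_tableau l T -> extends_filling T tau ->
    cell_of l T (size tau) = last (0, 0) tau.
  by move=> hT ft; rewrite Ek (cell_of_filling hT (st_sub S) ft) ?Ek // -nth_last Ek.
have next d D' : state l (rcons tau d) D' -> exists T,
    [/\ standard_tableau l T, extends_filling T (rcons tau d), late_data T (size tau).+1 D',
        cell_of l T (size tau) = last (0, 0) tau & cell_of l T (size tau).+1 = d].
  move=> S'; have [|T [hT fT dT]] := IH _ _ _ S'; first by rewrite size_rcons; clear -lt ltN; lia.
  exists T; split=> //; first by rewrite size_rcons in dT.
    by apply: lastE => //; exact: extends_rcons fT.
  rewrite (cell_of_filling hT (st_sub S') fT) ?size_rcons //.
  by rewrite nth_rcons ltnn eqxx.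
have [cl|ncl] := boolP (closer D (north (last (0, 0) tau))); last first.
  have [d [ad S' nd]] := step_right hl S ncl Kz zt.
  have [T [hT fT dT Ec Ed]] := next d D S'.
  exists T; split=> //; first exact: extends_rcons fT.
  by apply: late_step => //; rewrite /descent Ec Ed (negPf nd) andbF.
have [d [s [[ad S'] [sg fs] so [st ini] [ter nw]]]] := step_left hl S cl.
have [T [hT fT dT Ec Ed]] := next d _ S'.
have hd : descent l T (size tau).
  by rewrite /descent Ec Ed nw andbT Ek /=; move: ltN; rewrite Ek; clear; lia.
exists T; split=> //; first exact: extends_rcons fT.
apply: (late_step_descent ltN hd _ so) => //; last by rewrite ter.
apply: (descent_segment_unique hT (descent_segmentP hl hT hd)).
apply/(is_descent_segmentE hT); split=> //; rewrite ?Ec ?Ed //.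
have := below_filling hT (st_sub S') (st_uniq S') fT; rewrite size_rcons => bE.
by rewrite -(eq_all (a1 := frontier (mem (rcons tau d)))) // => v; rewrite /frontier !bE.
Qed.

(** No cell lies West or South of the least one, so its corner is not interior; the addable cells
    are among its direct successors, within one diagonal. *)
Lemma initial_state D m : balanced l D -> m \in K -> (forall c, c \in K -> cell_le m c) ->
  state l [:: m] D.
Proof.
move=> bD Km mm.
have nw : west m \notin K by apply/negP => /mm /(cell_le_anti (west_le m))/(congr1 ct); rewrite ctE; clear; lia.
have ns : south m \notin K by apply/negP => /mm /(cell_le_anti (south_le m))/(congr1 ct); rewrite ctE; clear; lia.
have nm : ~~ interior_vertex l m by rewrite interiorE (negPf nw) andbF.
split=> //.
- by move=> x; rewrite inE => /eqP ->.
- move=> x y; rewrite mem_seq1 => /eqP -> Ky ym; have -> := cell_le_anti ym (mm y Ky).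
  by rewrite mem_head leqnn.
- move=> v /(weight_interior bD)[vI _]; rewrite inE; apply: contraNneq nm => <- //.
- move=> v /(weight_interior bD)[_ vI]; rewrite inE; apply: contraNneq nm => <- //.
- move=> v /(starter_interior bD) vI; rewrite inE; apply: contraNneq ns => <-.
  by move: vI; rewrite interiorE => /and4P[].
- by move=> v _; rewrite inE => /eqP ->.
move=> d [[Kd dm ad] _ _ _] /=; rewrite inE in dm.
have [|[Kw le]|[Ks le]] := cell_pred hl Km Kd (mm d Kd).
- by rewrite eq_sym.
- have := ad _ Kw (west_le d); rewrite inE; case: eqP => [/(congr1 ct)|_ /(_ isT) /eqP <-];
  rewrite ?ctE; clear; lia.
- have := ad _ Ks (south_le d); rewrite inE; case: eqP => [/(congr1 ct)|_ /(_ isT) /eqP <-];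
  rewrite ?ctE; clear; lia.
Qed.

Lemma late_data_Des T D : standard_tableau l T -> late_data T 1 D ->
  same_data (data_of (Des l T)) D.
Proof.
move=> hT [H1 H2 H3].
have range i : descent l T i -> i \in iota 1 (N - 1).
  by case/andP => hi _; rewrite mem_iota; lia.
split=> [v w|v|v] /=.
- rewrite card_fset_filter H1; symmetry.
  apply: (count_pred_bij (f := descent_segment l T)); rewrite ?iota_uniq ?fset_uniq //.
    move=> i j; rewrite !mem_filter => /andP[/andP[hi _] _] /andP[/andP[hj _] _] E.
    by apply: (descent_segment_inj hl hT hi hj); rewrite E.
  move=> s; split=> [/andP[/DesP[i hi ->] vw]|[i [_ /andP[hi vw] ->]]].
    by exists i; split; rewrite ?range // hi.
  by rewrite vw andbT; apply/DesP; exists i.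
- rewrite H2; apply/hasP/hasP => [[s /DesP[i hi ->] E]|[i _ /andP[hi E]]].
    by exists i; rewrite ?range // hi.
  by exists (descent_segment l T i) => //; apply/DesP; exists i.
- rewrite H3; apply/hasP/hasP => [[s /DesP[i hi ->] E]|[i _ /andP[hi E]]].
    by exists i; rewrite ?range // hi.
  by exists (descent_segment l T i) => //; apply/DesP; exists i.
Qed.

Lemma tableau_exists D : balanced l D -> exists2 T, standard_tableau l T &
  same_data (data_of (Des l T)) D.
Proof.
move=> bD; have [E|/cells_min[//|m Km mm]] := eqVneq K fset0; last first.
  have [T [hT _ dT]] := realize_from (initial_state bD Km mm).
  by exists T => //; apply: late_data_Des.
(* The empty shape has no first cell to place, but no interior vertex either, so all data vanish. *)
have nI v : interior_vertex l v = false by rewrite interiorE E.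
have hT : standard_tableau l (fun=> 0%N).
  split; last by move=> c d; rewrite E.
  split=> [x /=|x y /set_mem /=|k /=]; rewrite ?E //.
  by rewrite /n_cells E cardfs0; lia.
exists (fun=> 0%N) => //; apply: late_data_Des => //; apply: late_data_zero.
- by rewrite /n_cells E cardfs0.
- by move=> v w; apply/eqP/negPn/negP => /(weight_interior bD)[]; rewrite nI.
- by move=> v; apply/negP => /(starter_interior bD); rewrite nI.
- by move=> v; apply/negP => /(closer_interior bD); rewrite nI.
Qed.

End Realization.

Lemma same_data_sym D E : same_data D E -> same_data E D.
Proof. by case=> h1 h2 h3; split=> [v w|v|v]; rewrite ?h1 ?h2 ?h3. Qed.

Lemma same_data_trans D E F : same_data D E -> same_data E F -> same_data D F.
Proof. by case=> h1 h2 h3 [g1 g2 g3]; split=> [v w|v|v]; rewrite ?h1 ?h2 ?h3 ?g1 ?g2 ?g3. Qed.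

(** * Statistics determined by the data *)

Section Statistics.
Variable l : grid_shape.
Variables X Y : {fset seq vertex}.
Hypotheses (sX : segments l X) (sY : segments l Y).
Hypotheses (eX : distinct_ends X) (eY : distinct_ends Y).
Hypothesis XY : same_data (data_of X) (data_of Y).

Definition isolated_vertex (D : twist_data) (v : vertex) : Prop :=
  [/\ starter D v, closer D v & forall w, weight D v w = 0%N /\ weight D w v = 0%N].

Lemma isolated_vertex_same D E v : same_data D E -> isolated_vertex D v -> isolated_vertex E v.
Proof.
case=> wE sE cE [h1 h2 h3]; split; rewrite -?sE -?cE // => w.
by rewrite -!wE.
Qed.

(** Any longer segment through the vertex uses an edge at it and so contributes weight there. *)
Lemma isolated_lazyE Z s : segments l Z -> s \in Z ->
  isolated_lazy Z s <-> isolated_vertex (data_of Z) (initial s).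
Proof.
move=> sZ sinZ; have sg := sZ _ sinZ; split.
  case/andP => /eqP s1 /allP iso; case: s s1 sinZ sg iso => [|v [|? ?]] // _ sinZ sg iso.
  have no t : t \in Z -> v \in t -> t = [:: v].
    move=> tZ vt; have := iso t tZ; case: eqP => //= _ /negP[].
    by have [a [b ->]] := mem_cat_split vt; apply/infixP; exists a, b.
  split; rewrite /initial /=.
  - by apply/hasP; exists [:: v].
  - by apply/hasP; exists [:: v].
  move=> w; rewrite !card_fset_filter; split; apply/eqP; rewrite -leqn0 leqNgt -has_count;
    apply/negP => /hasP[t tZ vw]; have := infix_mem vw => /andP[m1 m2];
    [have Et := no t tZ m1|have Et := no t tZ m2];
    move: vw => /size_infix; by rewrite Et.
case=> st cl w0.
have Es : s = [:: initial s].
  case: s sinZ sg st cl w0 => [|v [|w s]] // sinZ _ _ _ /(_ w)[/eqP]; rewrite /initial /=.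
  rewrite card_fset_filter -leqn0 leqNgt -has_count => /negP[].
  by apply/hasP; exists [:: v, w & s] => //; apply/infixP; exists [::], s.
apply/andP; split; first by rewrite Es.
apply/allP => t tZ; apply/implyP => ts; apply/negP; rewrite Es => vt.
have tg := sZ t tZ; have mt : initial s \in t by case/infixP: vt => a [b ->]; rewrite !mem_cat mem_head orbT.
have [a [b E]] := mem_cat_split mt.
case: b E => [|w b] E; last first.
  have [/eqP + _] := w0 w; rewrite /= card_fset_filter -leqn0 leqNgt -has_count => /negP[].
  by apply/hasP; exists t => //; rewrite E; apply/infixP; exists a, b.
case: (lastP a) E => [|a' w] E; first by move: ts; rewrite Es E eqxx.
have [_ /eqP] := w0 w; rewrite /= card_fset_filter -leqn0 leqNgt -has_count => /negP[].
by apply/hasP; exists t => //; rewrite E cat_rcons; apply/infixP; exists a', [::].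
Qed.

Lemma count_initial (P Q : pred (seq vertex)) :
  (forall s t, s \in X -> t \in Y -> initial s = initial t -> P s = Q t) ->
  count P X = count Q Y.
Proof.
move=> PQ; have [_ stE _] := XY.
rewrite -!size_filter -(size_map initial) -[in RHS](size_map initial).
apply/eqP; rewrite -uniq_size_uniq.
- rewrite map_inj_in_uniq ?filter_uniq ?fset_uniq // => s t.
  by rewrite !mem_filter => /andP[_ sx] /andP[_ tx]; apply: eX.1.
- rewrite map_inj_in_uniq ?filter_uniq ?fset_uniq // => s t.
  by rewrite !mem_filter => /andP[_ sy] /andP[_ ty]; apply: eY.1.
move=> v; apply/mapP/mapP => -[s]; rewrite mem_filter => /andP[Ps sZ] Ev.
  have : starter (data_of X) v by rewrite stE /=; apply/hasP; exists s; rewrite ?Ev.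
  case/hasP => t tX /eqP Et; exists t; rewrite ?Et // mem_filter.
  by apply/andP; split; rewrite // (PQ t s) // Et.
have : starter (data_of Y) v by rewrite -stE /=; apply/hasP; exists s; rewrite ?Ev.
case/hasP => t tY /eqP Et; exists t; rewrite ?Et // mem_filter.
by apply/andP; split; rewrite // -(PQ s t) // Et.
Qed.

Lemma same_card : #|` X|%fset = #|` Y|%fset.
Proof.
have := @count_initial predT predT (fun _ _ _ _ _ => erefl).
by rewrite !count_predT.
Qed.

Lemma same_isolated : n_isolated_lazy X = n_isolated_lazy Y.
Proof.
rewrite /n_isolated_lazy !card_fset_filter; apply: count_initial => s t sx ty E.
have e1 := isolated_lazyE sX sx; have e2 := isolated_lazyE sY ty; rewrite E in e1.
apply/idP/idP => [/e1 H|/e2 H]; [apply/e2|apply/e1].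
  exact: isolated_vertex_same XY H.
exact: isolated_vertex_same (same_data_sym XY) H.
Qed.

End Statistics.

Theorem proposition3p10 (l : grid_shape) (hl : reflected_skew_shape l) :
  (* the notions involved are well defined *)
  (forall (T : cell -> nat) (i : nat), standard_tableau l T -> descent l T i ->
     exists! s, is_descent_segment l T i s) /\
  (forall X, is_descent_set l X \/ nonfriendly_set l X ->
     balanced l (data_of X)) /\
  (forall X, is_descent_set l X -> exists! Y, is_twist l X Y) /\
  (* the twist map is a bijection preserving the two statistics *)
  set_bij [set X | is_descent_set l X]%classic
          [set Y | nonfriendly_set l Y]%classic (Tw l) /\
  (forall X, is_descent_set l X ->
     #|` Tw l X|%fset = #|` X|%fset /\
     n_isolated_lazy (Tw l X) = n_isolated_lazy X).
Proof.
have balDes X : is_descent_set l X -> balanced l (data_of X).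
  by case=> T hT ->; apply: balanced_data_of; [exact: Des_segments|exact: Des_ends].
have balNf X : nonfriendly_set l X -> balanced l (data_of X).
  move=> nf; apply: balanced_data_of; [exact: nonfriendly_segments|exact: nonfriendly_ends nf].
have twist X : is_descent_set l X -> exists! Y, is_twist l X Y.
  move=> /balDes bX; have [Y nY dY] := nonfriendly_exists bX.
  by exists Y; split=> // Z [nZ dZ]; apply: (nonfriendly_unique bX).
have TwP X : is_descent_set l X -> is_twist l X (Tw l X).
  move=> /twist[Y [tY _]].
  by apply: (@xgetPex _ fset0 [set Y | is_twist l X Y]%classic); exists Y.
split; first last.
  split; first by move=> X [/balDes|/balNf].
  split=> //; split; last first.
    move=> X dX; have [nY dY] := TwP X dX; case: (dX) => T hT EX.
    have sX : segments l X by rewrite EX; exact: Des_segments.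
    have eX : distinct_ends X by rewrite EX; exact: (Des_ends hl).
    have sY := nonfriendly_segments nY; have eY := nonfriendly_ends nY.
    by split; [exact: (same_card eY eX dY)|exact: (same_isolated sY sX eY eX dY)].
  split.
  - by move=> X /TwP[].
  - move=> X X' /set_mem /= dX /set_mem /= dX' E.
    have [_ h] := TwP X dX; have [_ h'] := TwP X' dX'; rewrite -E in h'.
    have bX := balDes X dX; case: dX dX' h h' bX => T hT -> [T' hT' ->] h h' bX.
    (* Both descent sets share the data of their common twist. *)
    apply: (Des_unique hl hT hT' bX); last exact: same_data_trans (same_data_sym h') h.
    by split.
  (* The twist of a descent set realizing the data of [Y] is nonfriendly with these data, hence
     equal to [Y]. *)
  move=> Y /= nY; have [T hT dT] := tableau_exists hl (balNf Y nY).
  have dX : is_descent_set l (Des l T) by exists T.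
  exists (Des l T) => //; have [nZ dZ] := TwP _ dX.
  by apply: (nonfriendly_unique (balNf Y nY) nZ (same_data_trans dZ dT) nY); split.
move=> T i hT hd; exists (descent_segment l T i); split; first exact: (descent_segmentP hl hT hd).
by move=> s hs; exact: (descent_segment_unique hT (descent_segmentP hl hT hd) hs).
Qed.
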